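(* Let $F=|\overline{y}|\sqrt{\phi(z,r)}$ be a Finsler metric defined on $M=\mathbb{R}\times\mathbb{B}^n(\rho)$, where $z=\frac{y^0}{|\overline{y}|}$ and $r=|\overline{x}|$. Then $F$ has vanishing Douglas curvature if, and only if, either (i) $F$ is a Randers metric of the form $$F(x,y)=f(r)\sqrt{g(r)(y^0)^2+|\overline{y}|^2}+b\,y^0,$$ where $f,g:J\subset\mathbb{R}\to\mathbb{R}$ are positive differentiable functions and $b$ is a constant such that $|b|^2<f^2(r)g(r)$; or (ii) $F$ is of the form $$F(x,y)=|\overline{y}|\,(h(r))^{-1}\,G\big(h(r)z\big),$$ where $h=h(r)$ and $G=G(t)$ are arbitrary positive (differentiable) functions such that $$G-tG'>0,\qquad G''>0.$$
   Context: Let $n\ge 2$, let $\mathbb{B}^n(\rho)\subset\mathbb{R}^n$ be the open ball of radius $\rho$ centred at the origin, and $M=\mathbb{R}\times\mathbb{B}^n(\rho)$ (so $\dim M=n+1$), with coordinates $x=(x^0,\overline{x})$, $\overline{x}=(x^1,\dots,x^n)$ and tangent coordinates $y=(y^0,\overline{y})$, $\overline{y}=(y^1,\dots,y^n)$; $|\cdot|$ is the Euclidean norm on $\mathbb{R}^n$. Capital indices run over $0,\dots,n$, lower case indices over $1,\dots,n$. A Finsler metric on $M$ is a function $F:TM\to[0,\infty)$ that is $C^\infty$ on $TM\setminus\{0\}$ and restricts to a Minkowski norm on each tangent space. The metrics considered have the form $F=|\overline{y}|\sqrt{\phi(z,r)}$ with $\phi$ a differentiable function of $z$ and $r$; identities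 written in terms of $z$ and $r$ are read at points with $\overline{y}\neq0$, $\overline{x}\neq0$. $J$ denotes the interval of values of $r$; $G$ is defined on $\mathbb{R}$. With $g_{AB}=\frac12[F^2]_{y^Ay^B}$, the spray coefficients are $G^C=\frac14 g^{CA}\left([F^2]_{y^Ax^B}y^B-[F^2]_{x^A}\right)$ (sum over repeated indices). The Douglas curvature is $$D^A_{BCD}=\frac{\partial^3}{\partial y^B\partial y^C\partial y^D}\left(G^A-\frac{1}{n+2}\sum_{E=0}^n\frac{\partial G^E}{\partial y^E}\,y^A\right),$$ and $F$ has vanishing Douglas curvature if $D^A_{BCD}=0$ for all indices. A Randers metric is $F=\alpha+\beta$ with $\alpha$ a Riemannian norm and $\beta$ a 1-form of $\alpha$-norm less than $1$. *)

(* Defs.v *)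
From mathcomp Require Import all_boot all_order all_algebra.
From mathcomp Require Import all_classical all_reals all_analysis.
Import Order.TTheory GRing.Theory Num.Theory.
Import numFieldNormedType.Exports.

Set Implicit Arguments.
Unset Strict Implicit.
Unset Printing Implicit Defensive.

Local Open Scope classical_set_scope.
Local Open Scope ring_scope.

(* For open U this is C^oo on U: every iterated directional derivative is
   Frechet differentiable, hence continuous, at every point of U. *)
Definition smooth_on (R : realType) (V : normedModType R) (U : set V)
    (f : V -> R^o) : Prop :=
  forall (vs : seq V) (p : V), U p ->
    differentiable (foldr (fun v (g : V -> R^o) q => 'D_v g q) f vs) p.

(* Differentiability relative to A, which need not be open: it is applied to the
   half-open interval [0, rho[, where it is one-sided at 0. *)
Definition differentiable_on (R : realType) (V : normedModType R) (A : set V)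
    (f : V -> R) : Prop :=
  forall p : V, A p -> exists L : {linear V -> R^o}, continuous L /\
    forall e : R, 0 < e ->
      \forall q \near within A (nbhs p),
        `|f q - f p - L (q - p)| <= e * `|q - p|.

(* The library norm on row vectors is the sup norm, hence this definition. *)
Definition enorm (R : realType) (n : nat) (v : 'rV[R]_n) : R :=
  Num.sqrt (\sum_(i < n) v 0 i ^+ 2).

(* Coordinates on R^(n+1) are v = (v^0, bar v); v^0 is the entry v 0 ord0. *)
Definition bar (R : realType) (n : nat) (v : 'rV[R]_n.+1) : 'rV[R]_n :=
  col' ord0 v.

Definition rcoord (R : realType) (n : nat) (x : 'rV[R]_n.+1) : R :=
  enorm (bar x).

(* Meaningful only for bar y != 0; as 1/0 = 0 here, it is 0 otherwise. *)
Definition zcoord (R : realType) (n : nat) (y : 'rV[R]_n.+1) : R :=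
  y 0 ord0 / enorm (bar y).

Definition cylinder (R : realType) (n : nat) (rho : R) : set 'rV[R]_n.+1 :=
  [set x | enorm (bar x) < rho].

Definition partial (R : realType) (n : nat) (A : 'I_n.+1)
    (f : 'rV[R]_n.+1 -> R) (p : 'rV[R]_n.+1) : R :=
  'D_(delta_mx 0 A : 'rV[R]_n.+1) (f : 'rV[R]_n.+1 -> R^o) p.

Definition dx (R : realType) (n : nat) (A : 'I_n.+1)
    (f : 'rV[R]_n.+1 -> 'rV[R]_n.+1 -> R) (x y : 'rV[R]_n.+1) : R :=
  partial A (fun x' => f x' y) x.

Definition dy (R : realType) (n : nat) (A : 'I_n.+1)
    (f : 'rV[R]_n.+1 -> 'rV[R]_n.+1 -> R) (x y : 'rV[R]_n.+1) : R :=
  partial A (f x) y.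

Definition posdef (R : realType) (n : nat) (a : 'M[R]_n) : Prop :=
  forall v : 'rV[R]_n, v != 0 -> 0 < (v *m a *m v^T) 0 0.

(* A subscripted derivative [f]_(AB) differentiates in A first. *)
Definition fundamental_tensor (R : realType) (n : nat) (N : 'rV[R]_n.+1 -> R)
    (y : 'rV[R]_n.+1) : 'M[R]_n.+1 :=
  \matrix_(A, B) (2^-1 * partial B (partial A (fun y' => N y' ^+ 2)) y).

Definition minkowski_norm (R : realType) (n : nat) (N : 'rV[R]_n.+1 -> R) :
    Prop :=
  [/\ forall y, 0 <= N y,
      forall y, N y = 0 <-> y = 0,
      forall (c : R) y, 0 < c -> N (c *: y) = c * N y,
      smooth_on [set y | y != 0] N
    & forall y, y != 0 -> posdef (fundamental_tensor N y)].

(* A metric on an open subset U of R^(n+1) is a function of the base point x and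
   the tangent vector y; its values at x outside U are irrelevant. *)
Definition finsler_metric (R : realType) (n : nat) (U : set 'rV[R]_n.+1)
    (F : 'rV[R]_n.+1 -> 'rV[R]_n.+1 -> R) : Prop :=
  smooth_on [set p : 'rV[R]_n.+1 * 'rV[R]_n.+1 | U p.1 /\ p.2 != 0]
    (fun p => F p.1 p.2) /\
  forall x, U x -> minkowski_norm (F x).

Definition sqf (R : realType) (n : nat)
    (F : 'rV[R]_n.+1 -> 'rV[R]_n.+1 -> R) (x y : 'rV[R]_n.+1) : R :=
  F x y ^+ 2.

Definition spray (R : realType) (n : nat)
    (F : 'rV[R]_n.+1 -> 'rV[R]_n.+1 -> R) (C : 'I_n.+1)
    (x y : 'rV[R]_n.+1) : R :=
  4^-1 * \sum_(A < n.+1) invmx (fundamental_tensor (F x) y) C A *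
    (\sum_(B < n.+1) dx B (dy A (sqf F)) x y * y 0 B - dx A (sqf F) x y).

Definition douglas_curvature (R : realType) (n : nat)
    (F : 'rV[R]_n.+1 -> 'rV[R]_n.+1 -> R) (A B C D : 'I_n.+1)
    (x y : 'rV[R]_n.+1) : R :=
  dy D (dy C (dy B (fun x y =>
    spray F A x y
    - n.+2%:R^-1 * (\sum_(E < n.+1) dy E (spray F E) x y) * y 0 A))) x y.

Definition vanishing_douglas (R : realType) (n : nat) (U : set 'rV[R]_n.+1)
    (F : 'rV[R]_n.+1 -> 'rV[R]_n.+1 -> R) : Prop :=
  forall (A B C D : 'I_n.+1) (x y : 'rV[R]_n.+1), U x -> y != 0 ->
    douglas_curvature F A B C D x y = 0.

Definition riemannian_metric (R : realType) (n : nat) (U : set 'rV[R]_n.+1)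
    (a : 'rV[R]_n.+1 -> 'M[R]_n.+1) : Prop :=
  (forall A B, smooth_on U (fun x => a x A B)) /\
  forall x, U x -> (a x)^T = a x /\ posdef (a x).

Definition randers_metric (R : realType) (n : nat) (U : set 'rV[R]_n.+1)
    (F : 'rV[R]_n.+1 -> 'rV[R]_n.+1 -> R) : Prop :=
  exists (a : 'rV[R]_n.+1 -> 'M[R]_n.+1) (b : 'rV[R]_n.+1 -> 'rV[R]_n.+1),
    [/\ riemannian_metric U a,
        forall A, smooth_on U (fun x => b x 0 A),
        forall x, U x -> Num.sqrt ((b x *m invmx (a x) *m (b x)^T) 0 0) < 1
      & forall x y, U x ->
          F x y = Num.sqrt ((y *m a x *m y^T) 0 0) + (b x *m y^T) 0 0].

(* Main.v *)
From HB Require Import structures.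
Require Import Defs.
From mathcomp Require Import all_boot all_order all_algebra.
From mathcomp Require Import all_classical all_reals all_analysis.
From mathcomp Require Import ring lra.
Import Order.TTheory GRing.Theory Num.Theory.
Import numFieldNormedType.Exports.

(** Let u = |bar y|, z = y^0 / u, r = |bar x|, and let psi be the square root of phi, so
    that F = u psi(z, r); primes are derivatives in z. Write m = psi - z psi'. Strong
    convexity of F says m > 0 and psi'' > 0 ([intercept_gt0], [dzz_gt0]), and solving for
    the spray ([spray_sphericalE]) gives
      G = P y + u^2 q bar x + <bar x, bar y> u eps e0,
      q = - psi_r / (2 r m),   eps = z q + psi'_r / (2 r psi'').
    The Douglas curvature ignores P. It vanishes exactly when the other two terms are
    quadratic in y, which means q = a z^2 + b and eps = d z with a, b, d depending on r
    only ([douglas0_spray_polynomial], [polynomial_spray_douglas]). Points with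
    bar x = 0 or bar y = 0 are reached by continuity ([generic_douglas]).

    For both families of the theorem q and eps are computed to be of this form
    ([scaling_profile_polynomial], [randers_profile_polynomial]).

    Conversely let q and eps be of this form. The first condition is the evolution
    equation psi_r = (A + B z^2) m, with A = - 2 r b and B = - 2 r a. Equality of the
    mixed derivatives of psi turns the second one into
    (d - 2 b - 2 a z^2) psi'' + 2 a m = 0. At a radius with B != 0 this ordinary
    differential equation in z has only the solutions psi = f sqrt (1 + g z^2) + b z
    ([randers_profile_ode], [polynomial_spray_evolution]). At a radius with B = 0 the
    evolution is an infinitesimal homothety of the (z, psi) plane.

    It remains to exclude a mixture of the two behaviours as r varies. Let the normalized
    profile at radius r be psi rescaled by the homothety that brings psi(0, r) to 1. The
    defect of a normalized profile measures how far it is from having Randers type. It is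
    stationary at every radius, whether B vanishes there or not
    ([randers_defect_derive]); hence it is constant. If B != 0 for some r, the defect
    vanishes identically and F is a Randers metric with constant b
    ([randers_alternative]). Otherwise the normalized profile itself is constant in r,
    which is the second family with h = 1 / psi(0, r) ([scaling_alternative]). *)

Set Implicit Arguments.
Unset Strict Implicit.
Unset Printing Implicit Defensive.

Local Open Scope classical_set_scope.
Local Open Scope ring_scope.

(** * Smooth functions on an open set of a normed space *)

Section FrechetCharacterization.
Variables (R : realType) (V : normedModType R).
Implicit Types f g : V -> R^o.

(** Unfolding Landau notation once gives a form in which a function can be replaced
    by one that agrees with it near p, and which compares directly with
    differentiability relative to a set. *)
Lemma differentiable_linear_approx f p : differentiable f p <->
  exists L : {linear V -> R^o}, continuous L /\
    forall e : R, 0 < e ->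
      \forall q \near p, `|f q - f p - L (q - p)| <= e * `|q - p|.
Proof.
split=> [/diffP[dc /funext E]|[L [Lc H]]].
  exists ('d f p); split=> // e e0.
  move: E => /eqaddoP /(_ e e0) /=.
  rewrite lim_id //; apply: filterS => q /=.
  by rewrite -![(_ + _ : _ -> _) _]/(_ + _) -![(- _ : _ -> _) _]/(- _)
     opprD addrA.
have E : f \o shift p = cst (f p) + L +o_ (0 : V) id.
  apply/eqaddoP => e e0.
  have := H e e0; rewrite (near_shift 0)/=; apply: filterS => q /=.
  rewrite -![(_ + _ : _ -> _) _]/(_ + _) -![(- _ : _ -> _) _]/(- _) /=.
  by rewrite /cst subr0 addrK opprD addrA.
have := diff_unique Lc E => dE.
by apply/diff_locallyP; rewrite dE; split.
Qed.

Lemma near_eq_differentiable f g p : (\near p, f p = g p) ->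
  differentiable f p -> differentiable g p.
Proof.
move=> fg /differentiable_linear_approx[L [Lc H]].
apply/differentiable_linear_approx; exists L; split=> // e e0.
have fgp := nbhs_singleton fg.
by near=> q; rewrite -fgp -(near fg q) //; near: q; exact: H.
Unshelve. all: by end_near. Qed.

End FrechetCharacterization.

Section SmoothFunctions.
Variables (R : realType) (V : normedModType R) (U : set V).
Hypothesis openU : open U.
Implicit Types f g : V -> R^o.

Let nearU p : U p -> \forall q \near p, U q.
Proof. by move=> Up; apply: open_nbhs_nbhs. Qed.

Let eqU_near f g p : (forall q, U q -> f q = g q) -> U p ->
  \near p, f p = g p.
Proof. by move=> fg Up; apply: filterS (nearU Up). Qed.

Lemma iter_derive_eq f g (vs : seq V) p : (forall q, U q -> f q = g q) -> U p ->
  foldr (fun v (h : V -> R^o) q => 'D_v h q) f vs p =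
  foldr (fun v (h : V -> R^o) q => 'D_v h q) g vs p.
Proof.
move=> fg; elim: vs p => [|v vs IH] p Up /=; first exact: fg.
by apply: near_eq_derive; apply: eqU_near Up => q Uq; exact: IH.
Qed.

Lemma smooth_on_differentiable f p : smooth_on U f -> U p -> differentiable f p.
Proof. by move=> sf Up; exact: (sf [::]). Qed.

Lemma smooth_on_derive f v : smooth_on U f -> smooth_on U (fun q => 'D_v f q).
Proof. by move=> sf vs p Up; have := sf (rcons vs v) p Up; rewrite foldr_rcons. Qed.

Lemma smooth_onI f : (forall p, U p -> differentiable f p) ->
  (forall v, smooth_on U (fun q => 'D_v f q)) -> smooth_on U f.
Proof.
move=> fd df vs p Up; elim/last_ind: vs => [|vs v _]; first exact: fd.
by rewrite foldr_rcons; exact: df.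
Qed.

(** Smoothness quantifies over all iterated derivatives, so it is proved by
    coinduction: a class of differentiable functions which contains, up to equality
    on U, the directional derivatives of its members consists of smooth functions. *)
Lemma smooth_on_coind (P : (V -> R^o) -> Prop) :
  (forall f p, P f -> U p -> differentiable f p) ->
  (forall f v, P f ->
     exists2 g : V -> R^o, P g & forall p, U p -> 'D_v f p = g p) ->
  forall f, P f -> smooth_on U f.
Proof.
move=> Pd Pder f Pf vs; elim/last_ind: vs f Pf => [|vs v IH] f Pf p Up /=.
  exact: Pd.
have [g Pg fg] := Pder f v Pf.
rewrite foldr_rcons; apply: (near_eq_differentiable _ (IH g Pg p Up)).
by apply: eqU_near Up => q Uq; apply: iter_derive_eq Uq => r Ur; rewrite fg.
Qed.

(** The derivative of an expression built from smooth functions with the field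
    operations is again such an expression (Leibniz and quotient rules). Hence this
    class meets the conditions of coinduction, and all algebraic closure properties
    of smooth functions follow at once. *)
Inductive smooth_expr : (V -> R^o) -> Prop :=
| SmoothBase f : smooth_on U f -> smooth_expr f
| SmoothEq f g : (forall p, U p -> f p = g p) -> smooth_expr g -> smooth_expr f
| SmoothCst c : smooth_expr (cst c)
| SmoothAdd f g : smooth_expr f -> smooth_expr g ->
    smooth_expr (fun p => f p + g p)
| SmoothMul f g : smooth_expr f -> smooth_expr g ->
    smooth_expr (fun p => (f p : R) * g p)
| SmoothInv f : smooth_expr f -> (forall p, U p -> f p != 0) ->
    smooth_expr (fun p => (f p : R)^-1).

Lemma smooth_expr_differentiable f p : smooth_expr f -> U p -> differentiable f p.
Proof.
move=> sf Up; elim: sf => {f} [f /smooth_on_differentiable|f g fg _ dg|c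
  |f g _ df _ dg|f g _ df _ dg|f _ df f0].
- exact.
- by apply: near_eq_differentiable dg; apply: eqU_near Up => q /fg.
- exact: differentiable_cst.
- exact: differentiableD.
- exact: (@differentiableM _ _ f g).
- by apply: differentiableV => //; exact: f0.
Qed.

Lemma smooth_expr_smooth f : smooth_expr f -> smooth_on U f.
Proof.
apply: smooth_on_coind => {}f; first exact: smooth_expr_differentiable.
move=> v; elim=> {f} [f sf|f g fg sg [h sh gh]|c
  |f g sf [f' sf' ff'] sg [g' sg' gg']|f g sf [f' sf' ff'] sg [g' sg' gg']
  |f sf [f' sf' ff'] f0].
- by exists ('D_v f) => //; apply/SmoothBase/smooth_on_derive.
- exists h => // p Up; rewrite -(gh _ Up).
  by apply: near_eq_derive; apply: eqU_near Up.
- by exists (cst 0); [exact: SmoothCst|move=> p _; rewrite derive_cst].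
- exists (fun p => f' p + g' p); first exact: SmoothAdd.
  move=> p Up; rewrite -ff' // -gg' //; apply: deriveD;
  exact/diff_derivable/smooth_expr_differentiable.
- exists (fun p => (f p : R) * g' p + (g p : R) * f' p).
    by apply: SmoothAdd; exact: SmoothMul.
  move=> p Up; rewrite -ff' // -gg' //; apply: (@deriveM _ _ f g);
  exact/diff_derivable/smooth_expr_differentiable.
- exists (fun p => ((-1 : R) * ((f p)^-1 * (f p)^-1)) * f' p : R).
    apply: SmoothMul => //; apply: (@SmoothMul (cst (-1))); first exact: SmoothCst.
    by apply: SmoothMul; exact: SmoothInv.
  move=> p Up; rewrite -ff' //; rewrite (@deriveV _ _ f) ?f0 //.
    by rewrite -exprVn expr2 -[LHS]/(_ * _) mulN1r.
  exact/diff_derivable/smooth_expr_differentiable.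
Qed.

Lemma smooth_on_eq f g : (forall p, U p -> f p = g p) ->
  smooth_on U g -> smooth_on U f.
Proof. by move=> fg /SmoothBase sg; apply/smooth_expr_smooth/(SmoothEq fg). Qed.

Lemma smooth_on_cst c : smooth_on U (cst c).
Proof. exact/smooth_expr_smooth/SmoothCst. Qed.

Lemma smooth_onD f g : smooth_on U f -> smooth_on U g ->
  smooth_on U (fun p => f p + g p).
Proof. by move=> /SmoothBase sf /SmoothBase sg; apply/smooth_expr_smooth/SmoothAdd. Qed.

Lemma smooth_onM (f g : V -> R) : smooth_on U f -> smooth_on U g ->
  smooth_on U (fun p => f p * g p).
Proof. by move=> /SmoothBase sf /SmoothBase sg; apply/smooth_expr_smooth/SmoothMul. Qed.

Lemma smooth_onV (f : V -> R) : smooth_on U f -> (forall p, U p -> f p != 0) ->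
  smooth_on U (fun p => (f p)^-1).
Proof. by move=> /SmoothBase sf f0; apply/smooth_expr_smooth/SmoothInv. Qed.

Lemma smooth_onZ (c : R) (f : V -> R) : smooth_on U f ->
  smooth_on U (fun p => c * f p).
Proof. by move=> sf; apply: smooth_onM => //; exact: smooth_on_cst. Qed.

Lemma smooth_onB f g : smooth_on U f -> smooth_on U g ->
  smooth_on U (fun p => f p - g p).
Proof.
move=> sf sg; apply: smooth_onD => //.
apply: (@smooth_on_eq _ (fun p => (-1 : R) * g p)); first by move=> p _; rewrite mulN1r.
exact: smooth_onZ.
Qed.

Lemma smooth_onX (f : V -> R) k : smooth_on U f -> smooth_on U (fun p => f p ^+ k).
Proof.
move=> sf; elim: k => [|k IH].
  by apply: smooth_on_eq (smooth_on_cst 1) => p _; rewrite expr0.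
by apply: smooth_on_eq (smooth_onM sf IH) => p _; rewrite exprS.
Qed.

Lemma smooth_on_sum (I : Type) (s : seq I) (P : pred I) (f : I -> V -> R) :
  (forall i, smooth_on U (f i)) -> smooth_on U (fun p => \sum_(i <- s | P i) f i p).
Proof.
move=> sf; elim: s => [|i s IH].
  by apply: smooth_on_eq (smooth_on_cst 0) => p _; rewrite big_nil.
case Pi : (P i).
  by apply: smooth_on_eq (smooth_onD (sf i) IH) => p _; rewrite big_cons Pi.
by apply: smooth_on_eq IH => p _; rewrite big_cons Pi.
Qed.

Lemma smooth_on_prod (I : Type) (s : seq I) (P : pred I) (f : I -> V -> R) :
  (forall i, smooth_on U (f i)) -> smooth_on U (fun p => \prod_(i <- s | P i) f i p).
Proof.
move=> sf; elim: s => [|i s IH].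
  by apply: smooth_on_eq (smooth_on_cst 1) => p _; rewrite big_nil.
case Pi : (P i).
  by apply: smooth_on_eq (smooth_onM (sf i) IH) => p _; rewrite big_cons Pi.
by apply: smooth_on_eq IH => p _; rewrite big_cons Pi.
Qed.

Lemma smooth_on_det k (M : V -> 'M[R]_k) :
  (forall i j, smooth_on U (fun p => M p i j)) -> smooth_on U (fun p => \det (M p)).
Proof.
move=> sM; rewrite /determinant; apply: smooth_on_sum => s.
by apply: smooth_onZ; apply: smooth_on_prod => i.
Qed.

(** Cramer's rule: the entries of the inverse are polynomials in the entries divided
    by the determinant. *)
Lemma smooth_on_invmx k (M : V -> 'M[R]_k) :
  (forall i j, smooth_on U (fun p => M p i j)) ->
  (forall p, U p -> M p \in unitmx) ->
  forall i j, smooth_on U (fun p => invmx (M p) i j).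
Proof.
move=> sM uM i j.
apply: (@smooth_on_eq _ (fun p => (\det (M p))^-1 * cofactor (M p) j i)).
  by move=> p Up; rewrite /invmx uM // !mxE.
apply: smooth_onM.
  apply: smooth_onV; first exact: smooth_on_det.
  by move=> p Up; have := uM p Up; rewrite unitmxE unitfE.
rewrite /cofactor; apply: smooth_onZ; apply: smooth_on_det => a b.
by apply: smooth_on_eq (sM (lift j a) (lift i b)) => p _; rewrite !mxE.
Qed.

End SmoothFunctions.

Section SmoothComposition.
Variables (R : realType) (V W : normedModType R).

Lemma derive_affine (A : {linear V -> W}) (c : W) (f : W -> R^o) p v :
  'D_v (fun q => f (A q + c)) p = 'D_(A v) f (A p + c).
Proof. by rewrite /derive /=; by under eq_fun do rewrite linearP -addrA. Qed.

(** A directional derivative of f composed with an affine map is a directional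
    derivative of f composed with the same map, so the class of such composites is
    stable under derivation. *)
Lemma smooth_on_affine (U : set W) (A : {linear V -> W}) (c : W) (f : W -> R^o) :
  open U -> continuous A -> smooth_on U f ->
  smooth_on [set q | U (A q + c)] (fun q => f (A q + c)).
Proof.
move=> oU Ac sf.
have Afc : continuous (fun q => A q + c).
  by move=> q; apply: cvgD; [exact: Ac|exact: cvg_cst].
have oU' : open [set q | U (A q + c)].
  by apply: open_comp => // q _; exact: Afc.
pose P (g : V -> R^o) := exists2 h, smooth_on U h & g = fun q => h (A q + c).
apply: (@smooth_on_coind _ _ _ oU' P); last by exists f.
- move=> _ p [h sh ->] Up.
  apply: (@differentiable_comp _ _ _ _ (fun q => A q + c) h).
    apply: differentiableD; last exact: differentiable_cst.
    exact: linear_differentiable.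
  exact: smooth_on_differentiable sh _.
- move=> _ v [h sh ->]; exists (fun q => 'D_(A v) h (A q + c)).
    by exists ('D_(A v) h) => //; exact: smooth_on_derive.
  by move=> p _; rewrite derive_affine.
Qed.

Lemma smooth_on_subset (U U' : set V) (f : V -> R^o) : U' `<=` U ->
  smooth_on U f -> smooth_on U' f.
Proof. by move=> sU sf vs p /sU Up; exact: sf. Qed.

End SmoothComposition.

(** * One-variable calculus along lines, and symmetry of mixed derivatives *)

Section LineRestriction.
Variables (R : realType) (V : normedModType R).
Implicit Types (f : V -> R^o) (v w p : V).

Lemma derive_lincomb f p (a : R) v w : differentiable f p ->
  'D_(a *: v + w) f p = a * 'D_v f p + 'D_w f p.
Proof. by move=> df; rewrite !deriveE // linearP. Qed.

Lemma is_derive_line f p v (t : R) : derivable f (p + t *: v) v ->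
  is_derive t (1 : R) (fun s : R => f (p + s *: v) : R) ('D_v f (p + t *: v)).
Proof.
have E : (fun h : R => h^-1 *: (((fun s : R => f (p + s *: v)) \o shift t) h%:A
             - f (p + t *: v))) =
         (fun h : R => h^-1 *: ((f \o shift (p + t *: v)) (h *: v)
             - f (p + t *: v))).
  apply/funext => h /=; congr (_ *: (f _ - _)).
  by rewrite [h%:A]mulr1 scalerDl addrCA.
move=> fd; apply: DeriveDef; first by rewrite /derivable E.
by rewrite /derive E.
Qed.

End LineRestriction.

Section OneVariable.
Variable R : realType.
Implicit Types f g : R -> R.

Lemma MVT_oo f df (a b : R) : a < b ->
  (forall t, a <= t <= b -> is_derive t 1 f (df t)) ->
  exists2 c, a < c < b & f b - f a = df c * (b - a).
Proof.
move=> ab fd.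
have [||c] := @MVT R f df a b ab.
- by move=> t; rewrite in_itv /= => /andP[/ltW at_ /ltW tb]; apply: fd; rewrite at_.
- apply: derivable_within_continuous => t; rewrite in_itv /= => tab.
  by have [] := fd t tab.
- by rewrite in_itv /= => cab E; exists c.
Qed.

Lemma derive0_constant f (J : set R) : is_interval J ->
  (forall t : R, J t -> is_derive t 1 f 0) -> forall s t, J s -> J t -> f s = f t.
Proof.
move=> iJ fd s t; wlog st : s t / s < t => [H Js Jt|Js Jt].
  by have [st|ts|->//] := ltgtP s t; [exact: H|rewrite (H t s)].
have [|c _] := @MVT_oo f (fun=> 0) s t st.
  by move=> u ust; apply: fd; exact: iJ ust.
by rewrite mul0r => /eqP; rewrite subr_eq0 => /eqP.
Qed.

Lemma derive0_constantT f : (forall t : R, is_derive t 1 f 0) -> forall s t, f s = f t.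
Proof. by move=> fd s t; exact: is_derive_0_is_cst. Qed.

Lemma derive_eq_constantT f g (df : R -> R) : (forall t : R, is_derive t 1 f (df t)) ->
  (forall t : R, is_derive t 1 g (df t)) -> forall t, f t = f 0 - g 0 + g t.
Proof.
move=> fd gd t.
have H s : is_derive (s : R) (1 : R) (f - g) 0.
  by apply: is_derive_eq; rewrite subrr.
have := derive0_constantT H t 0.
rewrite -![(_ - _ : _ -> _) _]/(_ - _) => <-; by rewrite subrK.
Qed.

Lemma third_derivative0_quadratic f f1 f2 :
  (forall t : R, is_derive t 1 f (f1 t)) -> (forall t : R, is_derive t 1 f1 (f2 t)) ->
  (forall t : R, is_derive t 1 f2 0) ->
  forall t, f t = f 0 + f1 0 * t + f2 0 / 2 * t ^+ 2.
Proof.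
move=> fd f1d f2d.
have f2E t : f2 t = f2 0 by exact: derive0_constantT.
have f1E t : f1 t = f1 0 + f2 0 * t.
  have H (s : R) : is_derive s (1 : R) (fun t : R => f2 0 * t) (f2 s).
    by apply: is_derive_eq; rewrite f2E /GRing.scale /=; ring.
  by rewrite (derive_eq_constantT f1d H t) mulr0 subr0.
move=> t.
have H (s : R) :
    is_derive s (1 : R) (fun t : R => f1 0 * t + f2 0 / 2 * t ^+ 2) (f1 s).
  by apply: is_derive_eq; rewrite (f1E s) /GRing.scale /=; field.
by rewrite (derive_eq_constantT fd H t) expr0n /= !mulr0 addr0 subr0 addrA.
Qed.

End OneVariable.

Section SymmetryOfMixedDerivatives.
Variables (R : realType) (V : normedModType R) (U : set V).
Hypothesis openU : open U.

(** The mean value theorem is applied in the direction v to the difference of f over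
    a step in the direction w, then in the direction w to the derivative so found. *)
Lemma second_difference (f : V -> R^o) p v w (h : R) : smooth_on U f -> 0 < h ->
  (forall a b, 0 <= a <= h -> 0 <= b <= h -> U (p + a *: v + b *: w)) ->
  exists2 ab : R * R, (0 <= ab.1 <= h) /\ (0 <= ab.2 <= h) &
    f (p + h *: v + h *: w) - f (p + h *: v) - f (p + h *: w) + f p =
    'D_w (fun q => 'D_v f q) (p + ab.1 *: v + ab.2 *: w) * (h * h).
Proof.
move=> sf h0 Uh.
have h00 : 0 <= (0 : R) <= h by rewrite lexx ltW.
have hh : 0 <= h <= h by rewrite lexx ltW.
have [|a ah E1] := @MVT_oo R
    (fun s => f (p + h *: w + s *: v) - f (p + s *: v))
    (fun s => 'D_v f (p + h *: w + s *: v) - 'D_v f (p + s *: v)) 0 h h0.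
  move=> s sh; apply: is_deriveB; apply: is_derive_line; apply: diff_derivable;
    apply: (smooth_on_differentiable sf).
    by rewrite addrAC; exact: Uh.
  by have := Uh s 0 sh h00; rewrite scale0r addr0.
have [|b bh E2] := @MVT_oo R
    (fun s => 'D_v f (p + a *: v + s *: w))
    (fun s => 'D_w (fun q => 'D_v f q) (p + a *: v + s *: w)) 0 h h0.
  move=> s sh; apply: (@is_derive_line _ _ (fun q => 'D_v f q)).
  apply: diff_derivable.
  apply: (smooth_on_differentiable (smooth_on_derive v sf)).
  by apply: Uh => //; case/andP: ah => /ltW -> /ltW ->.
exists (a, b); first by case/andP: ah => /ltW -> /ltW ->; case/andP: bh => /ltW -> /ltW ->.
move: E1 E2; rewrite /= !scale0r !addr0 !subr0 => E1 E2.
rewrite mulrA -E2 [p + a *: v + h *: w]addrAC -E1.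
rewrite [p + h *: w + h *: v]addrAC.
move: (f (_ + _)) (f (_ + _)) (f (_ + _)) (f p) => A B C D.
ring.
Qed.

(** The second difference of f over a small parallelogram is symmetric in its sides,
    so it equals the area factor times either mixed derivative at suitable points;
    as the parallelogram shrinks, continuity of both derivatives concludes. *)
Lemma mixed_derive_sym (f : V -> R^o) p v w : smooth_on U f -> U p ->
  'D_w (fun q => 'D_v f q) p = 'D_v (fun q => 'D_w f q) p.
Proof.
move=> sf Up.
pose g1 q : R := 'D_w (fun q => 'D_v f q) q; pose g2 q : R := 'D_v (fun q => 'D_w f q) q.
rewrite -[LHS]/(g1 p) -[RHS]/(g2 p).
apply/eqP; rewrite -subr_eq0 -normr_le0 /=; apply/ler_addgt0Pl => e e0; rewrite addr0.
have cg (g : V -> R^o) : smooth_on U g -> \forall q \near p, `|g p - g q| < e / 2.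
  move=> sg; have /differentiable_continuous := smooth_on_differentiable sg Up.
  by move=> /cvgrPdist_lt; apply; rewrite divr_gt0.
have s1 : smooth_on U g1 by do 2 apply: smooth_on_derive.
have s2 : smooth_on U g2 by do 2 apply: smooth_on_derive.
have N0 : nbhs p U by exact: open_nbhs_nbhs.
have /nbhs_ballP[d /= d0 Hd] : nbhs p (U `&` ([set q | `|g1 p - g1 q| < e / 2] `&`
    [set q | `|g2 p - g2 q| < e / 2])).
  by apply: filterI => //; apply: filterI; exact: cg.
(* With this step the whole parallelogram lies in the ball of radius d around p. *)
pose h := d / (2 * (1 + `|v| + `|w|)).
have K0 : 0 < 1 + `|v| + `|w| by rewrite -addrA ltr_pwDl // addr_ge0.
have h0 : 0 < h by rewrite divr_gt0 // mulr_gt0.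
have Hab a b : 0 <= a <= h -> 0 <= b <= h -> ball p d (p + a *: v + b *: w).
  move=> /andP[a0 ah] /andP[b0 bh]; rewrite -ball_normE /ball_ /=.
  rewrite -addrA opprD addrA subrr sub0r normrN.
  apply: le_lt_trans (ler_normD _ _) _; rewrite !normrZ !ger0_norm //.
  apply: (@le_lt_trans _ _ (h * (1 + `|v| + `|w|))).
    rewrite -addrA mulrDr mulr1 mulrDr; apply: ler_wpDl; first exact: ltW.
    by apply: lerD; apply: ler_wpM2r.
  rewrite /h invfM mulrA divfK ?gt_eqF // ltr_pdivrMr // ltr_pMr // ltr1n //.
have Uab a b : 0 <= a <= h -> 0 <= b <= h -> U (p + a *: v + b *: w).
  by move=> ah bh; have [] := Hd _ (Hab a b ah bh).
have [[a b] /= [ah bh] E1] := second_difference sf h0 Uab.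
have [|[b' a'] /= [bh' ah'] E2] := @second_difference f p w v h sf h0.
  by move=> b' a' ??; rewrite addrAC; exact: Uab.
have [_ [c1 _]] := Hd _ (Hab a b ah bh).
have [_ [_ c2]] := Hd _ (Hab a' b' ah' bh').
have E : g1 (p + a *: v + b *: w) = g2 (p + a' *: v + b' *: w).
  apply: (@mulIf _ (h * h)); first by rewrite mulf_neq0 // gt_eqF.
  rewrite -E1 [p + a' *: v + _]addrAC -E2 [p + h *: w + _]addrAC.
move: (f (_ + _)) (f (_ + _)) (f (_ + _)) (f p) => A B C D; ring.
apply: ltW; move: c1 c2 => /=; rewrite E; set x := g2 (_ + _).
move: (g1 p) (g2 p) => y z c1 c2.
have -> : y - z = (y - x) - (z - x) by ring.
apply: le_lt_trans (ler_normB _ _) _.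
by rewrite [e in _ < e]splitr ltrD.
Qed.

End SymmetryOfMixedDerivatives.

(** * Coordinates on the cylinder *)

Section ChainRule.
Variables (R : realType) (V : normedModType R).

(** A directional derivative only sees the line through x, which brings chain, product
    and inverse rules for functions on V back to one variable. *)
Lemma is_derive_lineP (f : V -> R^o) x v (df : R) :
  is_derive x v f df <-> is_derive (0 : R) (1 : R) (fun h : R => f (h *: v + x) : R) df.
Proof.
have E : (fun h : R => h^-1 *: (((fun s : R => f (s *: v + x)) \o shift 0) h%:A
             - f (0 *: v + x))) =
         (fun h : R => h^-1 *: ((f \o shift x) (h *: v) - f x)).
  by apply/funext => h /=; rewrite [h%:A]mulr1 scale0r add0r addr0.
by split=> -[fd <-]; apply: DeriveDef; rewrite ?/derivable ?/derive ?E //;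
  move: fd; rewrite /derivable E.
Qed.

Lemma is_derive_chain (f : V -> R) (g : R -> R) x v (df dg : R) :
  is_derive x v (f : V -> R^o) df -> is_derive (f x) (1 : R) g dg ->
  is_derive x v (fun y => g (f y) : R^o) (dg * df).
Proof.
move=> /is_derive_lineP fd gd; apply/is_derive_lineP.
apply: (@is_derive1_comp R g (fun h : R => f (h *: v + x))) => //.
by rewrite scale0r add0r.
Qed.

Lemma is_derive_mul (f g : V -> R) x v (df dg : R) :
  is_derive x v (f : V -> R^o) df -> is_derive x v (g : V -> R^o) dg ->
  is_derive x v (fun y => f y * g y : R^o) (f x * dg + g x * df).
Proof. by move=> fd gd; exact: is_deriveM. Qed.

Lemma is_derive_inv (f : V -> R) x v (df : R) : f x != 0 ->
  is_derive x v (f : V -> R^o) df ->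
  is_derive x v (fun y => (f y)^-1 : R^o) (- df / f x ^+ 2).
Proof.
move=> f0 fd.
have gd : is_derive (f x) (1 : R) (fun t : R => t^-1) (- (f x) ^- 2 *: 1).
  exact: (@is_deriveV R id).
apply: is_derive_eq (is_derive_chain fd gd) _.
by rewrite -[_ *: _]/(_ * _) mulr1 mulrC mulrN mulNr.
Qed.

End ChainRule.

Section BarCoordinates.
Variables (R : realType) (n : nat).
Implicit Types (v w x y : 'rV[R]_n.+1) (i : 'I_n).

Definition bdot v w : R := \sum_(i < n) bar v 0 i * bar w 0 i.

Lemma barE v i : bar v 0 i = v 0 (lift ord0 i).
Proof. by rewrite /bar !mxE. Qed.

Lemma bar_lin (a : R) v w : bar (a *: v + w) = a *: bar v + bar w.
Proof. by apply/rowP => i; rewrite !mxE. Qed.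

Lemma bdotC v w : bdot v w = bdot w v.
Proof. by apply: eq_bigr => i _; rewrite mulrC. Qed.

Lemma bdot_linl (a : R) v w x : bdot (a *: v + w) x = a * bdot v x + bdot w x.
Proof.
rewrite /bdot mulr_sumr -big_split /=; apply: eq_bigr => i _.
by rewrite bar_lin !mxE mulrDl mulrA.
Qed.

Lemma bdot_linr (a : R) v w x : bdot x (a *: v + w) = a * bdot x v + bdot x w.
Proof. by rewrite !(bdotC x) bdot_linl. Qed.

Lemma bdotZl (a : R) v x : bdot (a *: v) x = a * bdot v x.
Proof.
have -> : a *: v = a *: v + 0 by rewrite addr0.
rewrite bdot_linl; suff -> : bdot 0 x = 0 by rewrite addr0.
by rewrite /bdot big1 // => i _; rewrite barE mxE mul0r.
Qed.

Lemma bdotZr (a : R) v x : bdot x (a *: v) = a * bdot x v.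
Proof. by rewrite !(bdotC x) bdotZl. Qed.

Lemma bdot_ge0 v : 0 <= bdot v v.
Proof. by apply: sumr_ge0 => i _; rewrite -expr2 sqr_ge0. Qed.

Lemma enorm_bdot v : enorm (bar v) = Num.sqrt (bdot v v).
Proof. by rewrite /enorm; congr Num.sqrt; apply: eq_bigr => i _; rewrite expr2. Qed.

Lemma sqr_enorm v : enorm (bar v) ^+ 2 = bdot v v.
Proof. by rewrite enorm_bdot sqr_sqrtr // bdot_ge0. Qed.

Lemma bdot_eq0 v : (bdot v v == 0) = (bar v == 0).
Proof.
apply/eqP/eqP => [/eqP|E]; last first.
  by rewrite /bdot big1 // => i _; rewrite E mxE mul0r.
rewrite /bdot psumr_eq0 => [/allP H|i _]; last by rewrite -expr2 sqr_ge0.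
apply/rowP => i; have /= := H i (mem_index_enum i).
by rewrite -expr2 sqrf_eq0 => /eqP ->; rewrite mxE.
Qed.

Lemma bdot_gt0 v : bar v != 0 -> 0 < bdot v v.
Proof. by move=> v0; rewrite lt_def bdot_eq0 v0 bdot_ge0. Qed.

Lemma enorm_ge0 v : 0 <= enorm (bar v).
Proof. by rewrite enorm_bdot sqrtr_ge0. Qed.

Lemma enorm_gt0 v : bar v != 0 -> 0 < enorm (bar v).
Proof. by move=> v0; rewrite enorm_bdot sqrtr_gt0 bdot_gt0. Qed.

Lemma enormZ (a : R) v : enorm (bar (a *: v)) = `|a| * enorm (bar v).
Proof.
rewrite !enorm_bdot bdotZl bdotC bdotZl mulrA -expr2 sqrtrM ?sqr_ge0 //.
by rewrite sqrtr_sqr.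
Qed.

Lemma bar_neq0_neq0 v : bar v != 0 -> v != 0.
Proof.
by apply: contraNneq => ->; apply/eqP/rowP => i; rewrite !mxE.
Qed.

Lemma bdot_delta v i : bdot v (delta_mx 0 (lift ord0 i)) = v 0 (lift ord0 i).
Proof.
rewrite /bdot (bigD1 i) //= big1 => [|j ji]; first by rewrite !barE mxE !eqxx mulr1 addr0.
by rewrite !barE mxE eqxx (inj_eq lift_inj) (negbTE ji) mulr0.
Qed.

Lemma bdot_delta0 v : bdot v (delta_mx 0 ord0) = 0.
Proof. by rewrite /bdot big1 // => i _; rewrite !barE mxE /= mulr0. Qed.

Lemma row_sum_coord v : v = \sum_(A < n.+1) v 0 A *: delta_mx 0 A.
Proof. exact: row_sum_delta. Qed.

Lemma is_derive_coord (A : 'I_n.+1) y v :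
  is_derive y v (fun y : 'rV[R]_n.+1 => y 0 A : R^o) (v 0 A).
Proof.
apply/is_derive_lineP.
rewrite (_ : (fun h : R => _) = (fun h : R => h * v 0 A + y 0 A)); last first.
  by apply/funext => h; rewrite !mxE.
by apply: is_derive_eq; rewrite /GRing.scale /=; ring.
Qed.

Lemma is_derive_bdotl w y v : is_derive y v (fun y => bdot y w : R^o) (bdot v w).
Proof.
apply/is_derive_lineP; under eq_fun do rewrite bdot_linl.
by apply: is_derive_eq; rewrite /GRing.scale /=; ring.
Qed.

Lemma is_derive_bdot y v : is_derive y v (fun y => bdot y y : R^o) (2 * bdot y v).
Proof.
apply/is_derive_lineP.
rewrite (_ : (fun h : R => _) =
    (fun h : R => (h * bdot v v + bdot y v) * h + h * bdot y v + bdot y y)); last first.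
  by apply/funext => h; rewrite !bdot_linl !bdot_linr (bdotC v y); ring.
by apply: is_derive_eq; rewrite /GRing.scale /=; ring.
Qed.

(** The derivative of |bar y| in the direction v. The directional derivatives
    of z and of F are expressed through it. *)
Definition radial y v : R := bdot y v / enorm (bar y).

Lemma radial_lin (a : R) v w y : radial y (a *: v + w) = a * radial y v + radial y w.
Proof. by rewrite /radial bdot_linr mulrDl mulrA. Qed.

Lemma radial_self y : bar y != 0 -> radial y y = enorm (bar y).
Proof.
by move=> y0; rewrite /radial -sqr_enorm expr2 mulfK // gt_eqF // enorm_gt0.
Qed.

Lemma is_derive_enorm y v : bar y != 0 ->
  is_derive y v (fun y => enorm (bar y) : R^o) (radial y v).
Proof.
move=> y0; rewrite (_ : (fun y => _) = (fun y => Num.sqrt (bdot y y))); last first.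
  by apply/funext => w; rewrite enorm_bdot.
apply: is_derive_eq (is_derive_chain (is_derive_bdot y v) (is_derive1_sqrt (bdot_gt0 y0))) _.
rewrite /radial -enorm_bdot.
by field; rewrite gt_eqF // enorm_gt0.
Qed.

Lemma is_derive_zcoord y v : bar y != 0 ->
  is_derive y v (fun y => zcoord y : R^o)
    ((v 0 ord0 - zcoord y * radial y v) / enorm (bar y)).
Proof.
move=> y0; have u0 := enorm_gt0 y0.
apply: is_derive_eq (is_derive_mul (is_derive_coord ord0 y v)
  (is_derive_inv _ (is_derive_enorm v y0))) _; first by rewrite gt_eqF.
by rewrite /zcoord; field; rewrite gt_eqF.
Qed.

Lemma is_derive_radial y v w : bar y != 0 ->
  is_derive y w (fun y => radial y v : R^o)
    ((bdot v w - radial y v * radial y w) / enorm (bar y)).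
Proof.
move=> y0; have u0 := enorm_gt0 y0.
apply: is_derive_eq (is_derive_mul (is_derive_bdotl v y w)
  (is_derive_inv _ (is_derive_enorm w y0))) _; first by rewrite gt_eqF.
by rewrite /radial (bdotC w v); field; rewrite gt_eqF.
Qed.

Lemma smooth_on_coord (U : set 'rV[R]_n.+1) (A : 'I_n.+1) : open U ->
  smooth_on U (fun y => y 0 A : R^o).
Proof.
move=> oU; apply: smooth_onI => [y _|v]; first exact: differentiable_coord.
apply: smooth_on_eq (smooth_on_cst oU (v 0 A)) => // y _.
exact: (derive_val (is_derive := is_derive_coord A y v)).
Qed.

Lemma smooth_on_bdot (U : set 'rV[R]_n.+1) : open U ->
  smooth_on U (fun y => bdot y y : R^o).
Proof.
move=> oU; apply: smooth_on_sum => // i.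
apply: (smooth_on_eq oU (g := fun y => y 0 (lift ord0 i) * y 0 (lift ord0 i))).
  by move=> y _; rewrite barE.
by apply: smooth_onM => //; exact: smooth_on_coord.
Qed.

Lemma continuous_enorm_bar : continuous (fun y : 'rV[R]_n.+1 => enorm (bar y) : R^o).
Proof.
rewrite (_ : (fun y => _) = Num.sqrt \o (fun y : 'rV[R]_n.+1 => bdot y y)); last first.
  by apply/funext => y /=; rewrite enorm_bdot.
move=> y; apply: continuous_comp; last exact: sqrt_continuous.
apply: differentiable_continuous.
exact: (smooth_on_differentiable (smooth_on_bdot openT)).
Qed.

Lemma open_cylinder (rho : R) : open (cylinder rho : set 'rV[R]_n.+1).
Proof.
rewrite (_ : cylinder rho = (fun y : 'rV[R]_n.+1 => enorm (bar y) : R^o) @^-1`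
    [set t | t < rho]) //.
apply: open_comp; last exact: open_lt.
by move=> y _; exact: continuous_enorm_bar.
Qed.

Lemma open_bar_neq0 : open [set y : 'rV[R]_n.+1 | bar y != 0].
Proof.
rewrite (_ : [set y | _] = (fun y : 'rV[R]_n.+1 => enorm (bar y) : R^o) @^-1`
    [set t | 0 < t]).
  apply: open_comp; last exact: open_gt.
  by move=> y _; exact: continuous_enorm_bar.
apply/seteqP; split=> y /=; first exact: enorm_gt0.
by apply: contraTneq; rewrite enorm_bdot => /eqP; rewrite -bdot_eq0 => /eqP ->; rewrite sqrtr0 ltxx.
Qed.

End BarCoordinates.

(** * The profile of a spherically symmetric metric *)

Section PointwiseDerivatives.
Variables (R : realType) (V : normedModType R).

Lemma is_derive_add (f g : V -> R) x v (df dg : R) :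
  is_derive x v (f : V -> R^o) df -> is_derive x v (g : V -> R^o) dg ->
  is_derive x v (fun y => f y + g y : R^o) (df + dg).
Proof. by move=> fd gd; exact: is_deriveD. Qed.

Lemma is_derive_sub (f g : V -> R) x v (df dg : R) :
  is_derive x v (f : V -> R^o) df -> is_derive x v (g : V -> R^o) dg ->
  is_derive x v (fun y => f y - g y : R^o) (df - dg).
Proof. by move=> fd gd; exact: is_deriveB. Qed.

Lemma is_derive_const (c : R) (x v : V) : is_derive x v (fun=> c : R^o) 0.
Proof. exact: is_derive_cst. Qed.

Lemma is_derive_cmul (c : R) (f : V -> R) x v (df : R) :
  is_derive x v (f : V -> R^o) df -> is_derive x v (fun y => c * f y : R^o) (c * df).
Proof. by move=> fd; exact: is_deriveZ. Qed.

Lemma derive_near_eq (f g : V -> R^o) (U : set V) x v df : open U -> U x ->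
  (forall y, U y -> f y = g y) -> is_derive x v g df -> 'D_v f x = df.
Proof.
move=> oU Ux fg [_ <-]; apply: near_eq_derive.
by apply: filterS (open_nbhs_nbhs (conj oU Ux)) => y /fg.
Qed.

End PointwiseDerivatives.

Section SphericalProfile.
Variables (R : realType) (n : nat) (rho : R).
Variable F : 'rV[R]_n.+1 -> 'rV[R]_n.+1 -> R.
Variables i1 i2 : 'I_n.
Local Notation V := 'rV[R]_n.+1.
Local Notation P := (R^o * R^o)%type.
Local Notation E0 := (delta_mx 0 ord0 : V).
Local Notation e := (fun i => delta_mx 0 (lift ord0 i) : V).

(** The metric read on x = r e1 and y = (z, e2). For r > 0 it is the square root of
    phi, but it is smooth in (z, r) on an open strip that contains r = 0, because F is
    smooth; phi itself is only one-sided there. *)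
Definition profile (p : P) : R^o := F (p.2 *: e i1) (p.1 *: E0 + e i2).

Definition strip : set P := [set p | `|p.2| < rho].

Lemma open_strip : open strip.
Proof.
rewrite (_ : strip = (fun p : P => `|p.2|) @^-1` [set t | t < rho]) //.
apply: open_comp; last exact: open_lt.
by move=> p _; apply: continuous_comp; [exact: cvg_snd|exact: norm_continuous].
Qed.

Lemma enorm_e i : enorm (bar (e i)) = 1.
Proof. by rewrite enorm_bdot bdot_delta mxE !eqxx sqrtr1. Qed.

Lemma bar_e_neq0 i : bar (e i) != 0.
Proof. by rewrite -bdot_eq0 bdot_delta mxE !eqxx oner_eq0. Qed.

Lemma bar_zE0 z (v : V) : bar (z *: E0 + v) = bar v.
Proof. by rewrite bar_lin; apply/rowP => i; rewrite !mxE /= mulr0 add0r. Qed.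

Lemma rcoord_e r i : rcoord (r *: e i) = `|r|.
Proof. by rewrite /rcoord enormZ enorm_e mulr1. Qed.

Lemma zcoord_e z i : zcoord (z *: E0 + e i) = z.
Proof. by rewrite /zcoord bar_zE0 enorm_e divr1 !mxE !eqxx /= mulr1 addr0. Qed.

Lemma continuous_right_near_eq (f g : R -> R) (a : R) :
  {for a, continuous f} -> {for a, continuous g} ->
  (\forall t \near a^'+, f t = g t) -> f a = g a.
Proof.
move=> cf cg fg.
have fr : f t @[t --> a^'+] --> f a by exact: cvg_at_right_filter.
have gr : g t @[t --> a^'+] --> g a by exact: cvg_at_right_filter.
apply: (cvg_unique _ fr) => //; apply: cvg_trans gr; apply: near_eq_cvg.
by apply: filterS fg => t ->.
Qed.

Lemma continuous_right_eq (f g : R -> R) (a d : R) : 0 < d ->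
  {for a, continuous f} -> {for a, continuous g} ->
  (forall t, a < t < a + d -> f t = g t) -> f a = g a.
Proof.
move=> d0 cf cg fg; apply: continuous_right_near_eq => //.
near=> t; rewrite fg //; apply/andP; split; near: t.
  exact: nbhs_right_gt.
by apply: nbhs_right_lt; rewrite ltrDl.
Unshelve. all: by end_near. Qed.

(** The slit tangent bundle of the cylinder. *)
Definition slit : set (V * V) := [set p | cylinder rho p.1 /\ p.2 != 0].

Lemma open_neq0 : open [set y : V | y != 0].
Proof.
rewrite (_ : [set y | _] = (fun y : V => `|y|) @^-1` [set t | 0 < t]).
  apply: open_comp; last exact: open_gt.
  by move=> y _; exact: norm_continuous.
by apply/seteqP; split=> y /=; rewrite normr_gt0.
Qed.

Lemma open_slit : open slit.
Proof.
rewrite (_ : slit = (fst @^-1` cylinder rho) `&` (snd @^-1` [set y : V | y != 0])) //.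
apply: openI; apply: open_comp.
- by move=> p _; exact: cvg_fst.
- exact: open_cylinder.
- by move=> p _; exact: cvg_snd.
- exact: open_neq0.
Qed.

Hypothesis finslerF : finsler_metric (cylinder rho) F.

Lemma smooth_profile : smooth_on strip profile.
Proof.
pose A (p : P) : V * V := (p.2 *: e i1, p.1 *: E0).
have linA : linear A.
  move=> a p q; apply/pair_equal_spec; split; rewrite /A /=.
    by rewrite scalerDl -scalerA.
  by rewrite scalerDl -scalerA.
pose lA := GRing.isLinear.Build R P (V * V)%type *:%R A linA.
pose A' : {linear P -> (V * V)%type} := HB.pack A lA.
have cA : continuous A'.
  move=> p.
  have c1 : (q.2 *: e i1) @[q --> p] --> p.2 *: e i1 by apply: cvgZr_tmp; exact: cvg_snd.
  have c2 : (q.1 *: E0) @[q --> p] --> p.1 *: E0 by apply: cvgZr_tmp; exact: cvg_fst.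
  exact: (cvg_pair c1 c2).
have := @smooth_on_affine R P (V * V)%type slit A' (0, e i2) (fun q => F q.1 q.2)
  open_slit cA finslerF.1.
rewrite (_ : (fun q => _) = profile); last first.
  by apply/funext => p; rewrite /profile /= addr0.
apply: smooth_on_subset => p /= sp; split.
  by rewrite /cylinder /= addr0 -[enorm _]/(rcoord _) rcoord_e.
by apply: bar_neq0_neq0; rewrite bar_zE0 bar_e_neq0.
Qed.

Lemma continuous_F_line (x y v w : V) (t : R) : cylinder rho (x + t *: v) ->
  y + t *: w != 0 ->
  {for t, continuous (fun s : R => F (x + s *: v) (y + s *: w))}.
Proof.
move=> cx y0.
have dF : differentiable (fun p : V * V => F p.1 p.2 : R^o) (x + t *: v, y + t *: w).
  by apply: smooth_on_differentiable finslerF.1 _.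
have c (a b : V) : (a + s *: b) @[s --> t] --> a + t *: b.
  by apply: cvgD; [exact: cvg_cst|apply: cvgZr_tmp; exact: cvg_id].
apply: (@continuous_comp _ _ _ (fun t : R => (x + t *: v, y + t *: w))
  (fun p : V * V => F p.1 p.2)); last exact: differentiable_continuous dF.
exact: (cvg_pair (c x v) (c y w)).
Qed.

(** Where bar x != 0 this compares two points with the same z and r; at bar x = 0 it is
    the limit of that formula along x + t e1. *)
Lemma profile_formula (phi : R -> R -> R) : 0 < rho ->
  (forall x y : V, cylinder rho x -> bar x != 0 -> bar y != 0 ->
     F x y = enorm (bar y) * Num.sqrt (phi (zcoord y) (rcoord x))) ->
  forall x y, cylinder rho x -> bar y != 0 ->
    F x y = enorm (bar y) * profile (zcoord y, rcoord x).
Proof.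
move=> rho0 Fphi.
have profE z r : 0 < r < rho -> profile (z, r) = Num.sqrt (phi z r).
  move=> /andP[r0 rrho]; rewrite /profile /= Fphi.
  - by rewrite zcoord_e rcoord_e bar_zE0 enorm_e mul1r gtr0_norm.
  - by rewrite /cylinder /= -[enorm _]/(rcoord _) rcoord_e gtr0_norm.
  - by rewrite -bdot_eq0 -sqr_enorm -[enorm _]/(rcoord _) rcoord_e sqrf_eq0 normr_eq0 gt_eqF.
  - by rewrite bar_zE0 bar_e_neq0.
move=> x y cx y0; have [x0|x0] := eqVneq (bar x) 0; last first.
  by rewrite Fphi // profE // /rcoord enorm_gt0.
have r0 : rcoord x = 0 by rewrite /rcoord enorm_bdot; move/eqP: x0; rewrite -bdot_eq0 => /eqP ->; rewrite sqrtr0.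
have rt t : 0 < t -> rcoord (x + t *: e i1) = t.
  move=> t0; rewrite /rcoord (_ : bar (x + _) = bar (t *: e i1)).
    by rewrite -[enorm _]/(rcoord _) rcoord_e gtr0_norm.
  apply/rowP => i; have /rowP/(_ i) := x0; rewrite !mxE => ->.
  by rewrite add0r.
have := @continuous_right_eq (fun t => F (x + t *: e i1) (y + t *: 0))
  (fun t => enorm (bar y) * profile (zcoord y, t)) 0 rho rho0.
rewrite !scale0r !addr0 r0; apply.
- by apply: continuous_F_line; rewrite scale0r addr0 //; exact: bar_neq0_neq0.
- apply: cvgM; first exact: cvg_cst.
  apply: (@continuous_comp _ _ _ (fun t : R => (zcoord y, t) : P) profile).
    by apply: (cvg_pair (cvg_cst _) cvg_id).
  apply/differentiable_continuous/(smooth_on_differentiable smooth_profile).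
  by rewrite /strip /= normr0.
- move=> t; rewrite add0r => /andP[t0 tr]; rewrite scaler0 addr0 Fphi ?rt //.
  + by rewrite profE // t0.
  + by rewrite /cylinder /= -[enorm _]/(rcoord _) rt.
  + by rewrite -bdot_eq0 -sqr_enorm -[enorm _]/(rcoord _) rt // sqrf_eq0 gt_eqF.
Qed.

End SphericalProfile.

(** * Derivatives of the square of the metric *)

Section ProfileDerivatives.
Variable R : realType.
Local Notation P := (R^o * R^o)%type.
Variable rho : R.
Implicit Types g : P -> R^o.

Definition dz g : P -> R^o := fun p => 'D_((1, 0) : P) g p.
Definition dr g : P -> R^o := fun p => 'D_((0, 1) : P) g p.
(** The ordinate at 0 of the tangent line to the profile at z. It is also the partial
    derivative of F = |bar y| psi with respect to |bar y|, and its positivity is half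
    of the strong convexity of F. *)
Definition intercept g : P -> R^o := fun p => g p - p.1 * dz g p.

Lemma smooth_dz g : smooth_on (strip rho) g -> smooth_on (strip rho) (dz g).
Proof. exact: smooth_on_derive. Qed.

Lemma smooth_dr g : smooth_on (strip rho) g -> smooth_on (strip rho) (dr g).
Proof. exact: smooth_on_derive. Qed.

Lemma is_derive_dz g (z r : R) : smooth_on (strip rho) g -> `|r| < rho ->
  is_derive z (1 : R) (fun t : R => g (t, r) : R) (dz g (z, r)).
Proof.
move=> sg rr.
have E (t : R) : (0, r) + t *: ((1, 0) : P) = (t, r).
  by apply/pair_equal_spec; split; rewrite /= ?add0r ?[_ *: _]mulr1 // [_ *: _]mulr0 addr0.
have := @is_derive_line R _ g (0, r) (1, 0) z.
rewrite E (_ : (fun s : R => _) = (fun t : R => g (t, r))).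
  by apply; exact/diff_derivable/(smooth_on_differentiable sg).
by apply/funext => t; rewrite E.
Qed.

Lemma is_derive_dr g (z r : R) : smooth_on (strip rho) g -> `|r| < rho ->
  is_derive r (1 : R) (fun t : R => g (z, t) : R) (dr g (z, r)).
Proof.
move=> sg rr.
have E (t : R) : (z, 0) + t *: ((0, 1) : P) = (z, t).
  by apply/pair_equal_spec; split; rewrite /= ?add0r ?[_ *: _]mulr1 // [_ *: _]mulr0 addr0.
have := @is_derive_line R _ g (z, 0) (0, 1) r.
rewrite E (_ : (fun s : R => _) = (fun t : R => g (z, t))).
  by apply; exact/diff_derivable/(smooth_on_differentiable sg).
by apply/funext => t; rewrite E.
Qed.

Lemma dr_dz g p : smooth_on (strip rho) g -> strip rho p -> dr (dz g) p = dz (dr g) p.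
Proof. by move=> sg sp; apply: (mixed_derive_sym _ _ _ sg sp); exact: open_strip. Qed.

Lemma is_derive_intercept_z g (z r : R) : smooth_on (strip rho) g -> `|r| < rho ->
  is_derive z (1 : R) (fun t : R => intercept g (t, r) : R) (- z * dz (dz g) (z, r)).
Proof.
move=> sg rr; rewrite /intercept /=.
apply: is_derive_eq (is_derive_sub (is_derive_dz z sg rr)
  (is_derive_mul (is_derive_id _ _) (is_derive_dz z (smooth_dz sg) rr))) _.
by rewrite /=; ring.
Qed.

Lemma is_derive_intercept_r g (z r : R) : smooth_on (strip rho) g -> `|r| < rho ->
  is_derive r (1 : R) (fun t : R => intercept g (z, t) : R)
    (dr g (z, r) - z * dr (dz g) (z, r)).
Proof.
move=> sg rr; rewrite /intercept /=.
exact: (is_derive_sub (is_derive_dr z sg rr)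
  (is_derive_cmul z (is_derive_dr z (smooth_dz sg) rr))).
Qed.

End ProfileDerivatives.

(** The form F_v F_w + F F_vw of F = u psi(z), where u = |bar y|. Here s, t
    are the derivatives of u along v and w, a, b the axial components of v and w, and c
    is the inner product of their barred parts. It uses
    F_v = s (psi - z psi_z) + a psi_z and
    u F_vw = (c - s t) (psi - z psi_z) + (a - z s) (b - z t) psi_zz. *)
Definition tensor_form (R : realType) (f fz fzz z s t a b c : R) : R :=
  (s * (f - z * fz) + a * fz) * (t * (f - z * fz) + b * fz)
  + f * (f - z * fz) * (c - s * t) + f * fzz * (a - z * s) * (b - z * t).

Section SphericalMetric.
Variables (R : realType) (n : nat) (rho : R).
Variable F : 'rV[R]_n.+1 -> 'rV[R]_n.+1 -> R.
Variable psi : R^o * R^o -> R^o.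
Local Notation V := 'rV[R]_n.+1.
Hypothesis psi_smooth : smooth_on (strip rho) psi.
Hypothesis F_psi : forall x y, cylinder rho x -> bar y != 0 ->
  F x y = enorm (bar y) * psi (zcoord y, rcoord x).
Implicit Types (x y v w : V).

Local Notation pt x y := ((zcoord y, rcoord x) : R^o * R^o).

Lemma rcoord_lt x : cylinder rho x -> `|rcoord x| < rho.
Proof. by move=> cx; rewrite ger0_norm // enorm_ge0. Qed.

Lemma derive_sqf_y x y v : cylinder rho x -> bar y != 0 ->
  'D_v (sqf F x : V -> R^o) y = 2 * (enorm (bar y) * psi (pt x y)) *
    (radial y v * intercept psi (pt x y) + v 0 ord0 * dz psi (pt x y)).
Proof.
move=> cx y0; have u0 := enorm_gt0 y0; have rx := rcoord_lt cx.
have dpsi := is_derive_chain (is_derive_zcoord v y0)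
  (is_derive_dz (zcoord y) psi_smooth rx).
have dF := is_derive_mul (is_derive_enorm v y0) dpsi.
apply: (derive_near_eq (@open_bar_neq0 R n) y0 _ (is_derive_eq (is_derive_mul dF dF) _)).
  by move=> w w0; rewrite /sqf F_psi // expr2.
by rewrite /intercept /=; field; rewrite gt_eqF.
Qed.

Lemma derive2_sqf_y x y v w : cylinder rho x -> bar y != 0 ->
  'D_w (fun y => 'D_v (sqf F x : V -> R^o) y) y =
  2 * tensor_form (psi (pt x y)) (dz psi (pt x y)) (dz (dz psi) (pt x y))
    (zcoord y) (radial y v) (radial y w) (v 0 ord0) (w 0 ord0) (bdot v w).
Proof.
move=> cx y0; have u0 := enorm_gt0 y0; have rx := rcoord_lt cx.
have zd := is_derive_zcoord w y0.
have dpsi := is_derive_chain zd (is_derive_dz (zcoord y) psi_smooth rx).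
have dint := is_derive_chain zd (is_derive_intercept_z (zcoord y) psi_smooth rx).
have dpsiz := is_derive_chain zd (is_derive_dz (zcoord y) (smooth_dz psi_smooth) rx).
have D := is_derive_mul
  (is_derive_cmul 2 (is_derive_mul (is_derive_enorm w y0) dpsi))
  (is_derive_add (is_derive_mul (is_derive_radial v w y0) dint)
    (is_derive_cmul (v 0 ord0) dpsiz)).
apply: (derive_near_eq (@open_bar_neq0 R n) y0 _ (is_derive_eq D _)).
  by move=> y' y'0; rewrite derive_sqf_y.
by rewrite /intercept /tensor_form /=; field; rewrite gt_eqF.
Qed.

Lemma open_punctured_cylinder : open (cylinder rho `&` [set x : V | bar x != 0]).
Proof. by apply: openI; [exact: open_cylinder|exact: open_bar_neq0]. Qed.

Lemma derive_sqf_yx x y v w : cylinder rho x -> bar x != 0 -> bar y != 0 ->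
  'D_w (fun x => 'D_v (sqf F x : V -> R^o) y : R^o) x =
  2 * enorm (bar y) * radial x w *
  (dr psi (pt x y) * (radial y v * intercept psi (pt x y) + v 0 ord0 * dz psi (pt x y))
   + psi (pt x y) * (radial y v * (dr psi (pt x y) - zcoord y * dr (dz psi) (pt x y))
       + v 0 ord0 * dr (dz psi) (pt x y))).
Proof.
move=> cx x0 y0; have rx := rcoord_lt cx.
have rd := is_derive_enorm w x0.
have dpsi := is_derive_chain rd (is_derive_dr (zcoord y) psi_smooth rx).
have dint := is_derive_chain rd (is_derive_intercept_r (zcoord y) psi_smooth rx).
have dpsiz := is_derive_chain rd (is_derive_dr (zcoord y) (smooth_dz psi_smooth) rx).
have D := is_derive_mul (is_derive_cmul 2 (is_derive_cmul (enorm (bar y)) dpsi))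
  (is_derive_add (is_derive_cmul (radial y v) dint) (is_derive_cmul (v 0 ord0) dpsiz)).
apply: (derive_near_eq open_punctured_cylinder _ _ (is_derive_eq D _)) => //.
  by move=> x' [cx' _]; rewrite derive_sqf_y.
by rewrite /=; ring.
Qed.

Lemma derive_sqf_x x y w : cylinder rho x -> bar x != 0 -> bar y != 0 ->
  'D_w (fun x => sqf F x y : R^o) x =
  2 * enorm (bar y) ^+ 2 * psi (pt x y) * dr psi (pt x y) * radial x w.
Proof.
move=> cx x0 y0; have rx := rcoord_lt cx.
have rd := is_derive_enorm w x0.
have dpsi := is_derive_chain rd (is_derive_dr (zcoord y) psi_smooth rx).
have dF := is_derive_cmul (enorm (bar y)) dpsi.
apply: (derive_near_eq open_punctured_cylinder _ _ (is_derive_eq (is_derive_mul dF dF) _)) => //.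
  by move=> x' [cx' _]; rewrite /sqf F_psi // expr2.
by rewrite /=; ring.
Qed.

End SphericalMetric.

(** * Strong convexity in terms of the profile *)

Section SphericalSpray.
Variables (R : realType) (n : nat) (rho : R).
Variable F : 'rV[R]_n.+1 -> 'rV[R]_n.+1 -> R.
Variable psi : R^o * R^o -> R^o.
Variables i1 i2 : 'I_n.
Local Notation V := 'rV[R]_n.+1.
Local Notation E0 := (delta_mx 0 ord0 : V).
Local Notation e := (fun i => delta_mx 0 (lift ord0 i) : V).
Hypothesis i12 : i1 != i2.
Hypothesis finslerF : finsler_metric (cylinder rho) F.
Hypothesis psi_smooth : smooth_on (strip rho) psi.
Hypothesis F_psi : forall x y, cylinder rho x -> bar y != 0 ->
  F x y = enorm (bar y) * psi (zcoord y, rcoord x).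
Implicit Types (x y v w : V).

Local Notation pt x y := ((zcoord y, rcoord x) : R^o * R^o).

Lemma linear_coord_sum (l : V -> R) : (forall a v w, l (a *: v + w) = a * l v + l w) ->
  forall w, \sum_(B < n.+1) l (delta_mx 0 B) * w 0 B = l w.
Proof.
move=> ll w; rewrite [in RHS](row_sum_coord w).
have l0 : l 0 = 0.
  by have := ll (-1) 0 0; rewrite scaler0 addr0 mulN1r addNr.
elim: (index_enum _) => [|B s IH]; first by rewrite !big_nil l0.
by rewrite !big_cons ll IH mulrC.
Qed.

Definition tensor_at x y v w : R :=
  tensor_form (psi (pt x y)) (dz psi (pt x y)) (dz (dz psi) (pt x y))
    (zcoord y) (radial y v) (radial y w) (v 0 ord0) (w 0 ord0) (bdot v w).

Lemma tensor_at_linr x y v a w w' :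
  tensor_at x y v (a *: w + w') = a * tensor_at x y v w + tensor_at x y v w'.
Proof. by rewrite /tensor_at /tensor_form radial_lin bdot_linr !mxE; ring. Qed.

Lemma tensor_atC x y v w : tensor_at x y v w = tensor_at x y w v.
Proof. by rewrite /tensor_at /tensor_form (bdotC v w); ring. Qed.

Lemma fundamental_tensor_at x y A B : cylinder rho x -> bar y != 0 ->
  fundamental_tensor (F x) y A B = tensor_at x y (delta_mx 0 A) (delta_mx 0 B).
Proof.
move=> cx y0; rewrite /fundamental_tensor mxE /partial.
have := derive2_sqf_y psi_smooth F_psi (delta_mx 0 A) (delta_mx 0 B) cx y0.
by rewrite /sqf => ->; rewrite mulKf ?pnatr_eq0.
Qed.

Lemma fundamental_tensor_row x y A w : cylinder rho x -> bar y != 0 ->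
  \sum_(B < n.+1) fundamental_tensor (F x) y A B * w 0 B =
  tensor_at x y (delta_mx 0 A) w.
Proof.
move=> cx y0.
rewrite -(linear_coord_sum (tensor_at_linr x y (delta_mx 0 A)) w).
by apply: eq_bigr => B _; rewrite fundamental_tensor_at.
Qed.

Lemma fundamental_tensor_form x y v : cylinder rho x -> bar y != 0 ->
  (v *m fundamental_tensor (F x) y *m v^T) 0 0 = tensor_at x y v v.
Proof.
move=> cx y0; rewrite -mulmxA mxE.
have L a w w' : tensor_at x y (a *: w + w') v = a * tensor_at x y w v + tensor_at x y w' v.
  by rewrite !(tensor_atC x y _ v) tensor_at_linr.
rewrite -(linear_coord_sum L v); apply: eq_bigr => A _.
rewrite -(fundamental_tensor_row A v cx y0) mulrC mxE; congr (_ * _).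
by apply: eq_bigr => B _; rewrite [v^T _ _]mxE.
Qed.

Section AtRadius.
Variables (z r : R).
Hypothesis r_range : 0 <= r < rho.
Let x := r *: e i1.
Let y := z *: E0 + e i2.

Let cx : cylinder rho x.
Proof.
case/andP: r_range => r0 rr.
by rewrite /cylinder /= -[enorm _]/(rcoord _) rcoord_e ger0_norm.
Qed.

Let rx : rcoord x = r.
Proof. by case/andP: r_range => r0 _; rewrite rcoord_e ger0_norm. Qed.

Let by0 : bar y != 0. Proof. by rewrite bar_zE0 bar_e_neq0. Qed.

Let radial_y v : radial y v = v 0 (lift ord0 i2).
Proof. by rewrite /radial bar_zE0 enorm_e divr1 bdot_linl bdotC bdot_delta0 mulr0 add0r bdotC bdot_delta. Qed.

Lemma F_at_profile_point : F x y = psi (z, r).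
Proof. by rewrite F_psi // rx zcoord_e bar_zE0 enorm_e mul1r. Qed.

Let tensor_pos v : v != 0 -> 0 < tensor_at x y v v.
Proof.
move=> v0; have [_ _ _ _ pd] := finslerF.2 x cx.
by rewrite -fundamental_tensor_form //; apply: pd => //; exact: bar_neq0_neq0.
Qed.

Lemma psi_gt0 : 0 < psi (z, r).
Proof.
have [F0 F00 _ _ _] := finslerF.2 x cx.
rewrite -F_at_profile_point lt_def F0 andbT.
by apply/eqP => /F00 /eqP; apply/negP; exact: bar_neq0_neq0.
Qed.

(** The fundamental tensor is evaluated on the direction e1, which is orthogonal to the
    barred part e2 of y; this needs a second barred dimension. *)
Lemma intercept_gt0 : 0 < intercept psi (z, r).
Proof.
have := @tensor_pos (e i1) (bar_neq0_neq0 (bar_e_neq0 _ i1)).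
rewrite /tensor_at /tensor_form !radial_y bdot_delta !mxE rx zcoord_e !eqxx /=.
rewrite (inj_eq lift_inj) eq_sym (negbTE i12) /=.
rewrite !(mul0r, mulr0, add0r, oppr0, addr0, mulr1).
by rewrite pmulr_rgt0 // psi_gt0.
Qed.

(** The fundamental tensor is evaluated on the direction in the plane of y and the axis
    that is tangent to the indicatrix, where only F F_vv remains. *)
Lemma dzz_gt0 : 0 < dz (dz psi) (z, r).
Proof.
set m := intercept psi (z, r).
have m0 : 0 < m := intercept_gt0.
have p0 := psi_gt0.
pose v := m *: E0 + (- dz psi (z, r)) *: e i2.
have v0 : v 0 ord0 = m by rewrite !mxE !eqxx /= mulr0 addr0 mulr1.
have v2 : v 0 (lift ord0 i2) = - dz psi (z, r).
  by rewrite !mxE !eqxx /= mulr0 add0r mulr1.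
have vv : bdot v v = dz psi (z, r) ^+ 2.
  rewrite {2}/v bdot_linr bdot_delta0 bdotC bdotZl bdotC bdot_delta v2; ring.
have /tensor_pos : v != 0.
  by apply/eqP => /rowP/(_ ord0); rewrite v0 mxE => /eqP; rewrite gt_eqF.
rewrite /tensor_at /tensor_form !radial_y rx zcoord_e vv v0 v2.
rewrite /m /intercept /=; set f := psi _; set fz := dz psi _; set fzz := dz (dz psi) _.
have -> : (- fz * (f - z * fz) + (f - z * fz) * fz) *
  (- fz * (f - z * fz) + (f - z * fz) * fz) +
  f * (f - z * fz) * (fz ^+ 2 - - fz * - fz) +
  f * fzz * (f - z * fz - z * - fz) * (f - z * fz - z * - fz) = f ^+ 3 * fzz by ring.
by rewrite pmulr_rgt0 // exprn_gt0.
Qed.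

End AtRadius.

End SphericalSpray.

(** * The spray coefficients *)

Lemma posdef_unitmx (R : realType) (k : nat) (a : 'M[R]_k) : posdef a -> a \in unitmx.
Proof.
move=> pa; rewrite -row_free_unit -kermx_eq0; apply/rowV0P => v /sub_kermxP va.
by apply/eqP; apply/negPn/negP => /pa; rewrite va mul0mx mxE ltxx.
Qed.

Section SprayCharacterization.
Variables (R : realType) (n : nat).
Variable F : 'rV[R]_n.+1 -> 'rV[R]_n.+1 -> R.
Local Notation V := 'rV[R]_n.+1.
Implicit Types (x y w : V).

Lemma spray_unique x y w : posdef (fundamental_tensor (F x) y) ->
  (forall A, 4 * \sum_(B < n.+1) fundamental_tensor (F x) y A B * w 0 B =
     \sum_(B < n.+1) dx B (dy A (sqf F)) x y * y 0 B - dx A (sqf F) x y) ->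
  forall C, spray F C x y = w 0 C.
Proof.
move=> /posdef_unitmx ug eqw C; set g := fundamental_tensor _ _ in ug eqw *.
rewrite /spray -/g; under eq_bigr do rewrite -eqw mulrCA.
rewrite -mulr_sumr mulKf ?pnatr_eq0 //.
transitivity ((invmx g *m (g *m w^T)) C 0); last by rewrite mulKmx // mxE.
rewrite mxE; apply: eq_bigr => A _; congr (_ * _); rewrite mxE.
by apply: eq_bigr => B _; rewrite [w^T _ _]mxE.
Qed.

End SprayCharacterization.

Section SprayFormula.
Variables (R : realType) (n : nat) (rho : R).
Variable F : 'rV[R]_n.+1 -> 'rV[R]_n.+1 -> R.
Variable psi : R^o * R^o -> R^o.
Variables i1 i2 : 'I_n.
Local Notation V := 'rV[R]_n.+1.
Local Notation E0 := (delta_mx 0 ord0 : V).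
Hypothesis i12 : i1 != i2.
Hypothesis finslerF : finsler_metric (cylinder rho) F.
Hypothesis psi_smooth : smooth_on (strip rho) psi.
Hypothesis F_psi : forall x y, cylinder rho x -> bar y != 0 ->
  F x y = enorm (bar y) * psi (zcoord y, rcoord x).
Implicit Types (x y v w : V) (p : R^o * R^o).

Local Notation pt x y := ((zcoord y, rcoord x) : R^o * R^o).

(** With w the inner product of bar x and bar y and u = |bar y|, the spray is
    G = P y + u^2 q bar x + w u eps e0. The functions q and eps of (z, r) below carry the
    whole Douglas curvature; the component P along y does not contribute to it. *)
Definition spray_radial p : R := - dr psi p / (2 * p.2 * intercept psi p).

Definition spray_axial p : R :=
  p.1 * spray_radial p + dr (dz psi) p / (2 * p.2 * dz (dz psi) p).

Definition spray_parallel p : R :=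
  let X := psi p * intercept psi p in
  let Xz := dz psi p * intercept psi p - psi p * p.1 * dz (dz psi) p in
  let Xr := dr psi p * intercept psi p + psi p * (dr psi p - p.1 * dr (dz psi) p) in
  (Xr - Xz * dr (dz psi) p / dz (dz psi) p) / (2 * p.2 * X).

Definition spray_vector x y : V :=
  (bdot x y * spray_parallel (pt x y)) *: y +
  ((enorm (bar y) ^+ 2 * spray_radial (pt x y)) *: ((- x 0 ord0) *: E0 + x) +
   (bdot x y * enorm (bar y) * spray_axial (pt x y)) *: E0).

(** The vector G is not computed by inverting the fundamental tensor: it is enough to
    check that it solves the linear system that defines the spray. *)
Lemma spray_sphericalE x y C : cylinder rho x -> bar x != 0 -> bar y != 0 ->
  spray F C x y = spray_vector x y 0 C.
Proof.
move=> cx x0 y0; apply: spray_unique.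
  have [_ _ _ _] := finslerF.2 x cx; apply; exact: bar_neq0_neq0.
move=> A; rewrite (fundamental_tensor_row psi_smooth F_psi) //.
have u0 := enorm_gt0 y0; have r0 : 0 < rcoord x := enorm_gt0 x0.
have rr : 0 <= rcoord x < rho by rewrite ltW.
have f0 := psi_gt0 i1 i2 finslerF F_psi (zcoord y) rr.
have m0 := intercept_gt0 i12 finslerF psi_smooth F_psi (zcoord y) rr.
have fzz0 := dzz_gt0 i12 finslerF psi_smooth F_psi (zcoord y) rr.
set v := delta_mx 0 A.
pose K : R := 2 * enorm (bar y) *
  (dr psi (pt x y) * (radial y v * intercept psi (pt x y) + v 0 ord0 * dz psi (pt x y))
   + psi (pt x y) * (radial y v * (dr psi (pt x y) - zcoord y * dr (dz psi) (pt x y))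
       + v 0 ord0 * dr (dz psi) (pt x y))).
have -> : \sum_(B < n.+1) dx B (dy A (sqf F)) x y * y 0 B = K * radial x y.
  rewrite -(linear_coord_sum (fun a v w => radial_lin a v w x) y) mulr_sumr.
  apply: eq_bigr => B _.
  rewrite /dx /partial /dy /partial (derive_sqf_yx psi_smooth F_psi) // /K -/v; ring.
rewrite /dx /partial (derive_sqf_x psi_smooth F_psi) // -/v.
rewrite /tensor_at /tensor_form /spray_vector /K {K}; clearbody v.
rewrite !(radial_lin, bdot_linr) !mxE !eqxx /=.
rewrite /radial !bdotZr !bdot_delta0 !(bdotC y x) !(bdotC v x) !(bdotC v y) -!sqr_enorm.
have -> : y 0 ord0 = zcoord y * enorm (bar y) by rewrite /zcoord divfK // gt_eqF.
rewrite /spray_parallel /spray_axial /spray_radial /=.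
move: m0; rewrite /intercept /=.
move: f0 fzz0 u0 r0; rewrite -[enorm (bar x)]/(rcoord x).
move: (psi _) (dz psi _) (dz (dz psi) _) (dr psi _) (dr (dz psi) _) => f fz fzz fr fzr.
move: (zcoord y) (rcoord x) (enorm (bar y)) (bdot x y) (bdot x v) (bdot y v) (v 0 ord0) (x 0 ord0).
move=> z r u w a b c d f0 fzz0 u0 r0 m0.
by field; rewrite ?gt_eqF.
Qed.

End SprayFormula.

(** * Smoothness of the spray and of the Douglas curvature *)

Section SmoothSpray.
Variables (R : realType) (n : nat) (rho : R).
Variable F : 'rV[R]_n.+1 -> 'rV[R]_n.+1 -> R.
Local Notation V := 'rV[R]_n.+1.
Local Notation uncurried f := (fun p : V * V => f p.1 p.2 : R^o).
Implicit Types f : V -> V -> R.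

Lemma derive_snd f (p : V * V) v :
  'D_(0, v) (uncurried f) p = 'D_v (f p.1 : V -> R^o) p.2.
Proof.
case: p => x y; rewrite /derive; set a := (fun h : R => _); set b := (fun h : R => _).
suff -> : a = b by [].
by apply/funext => h; rewrite /a /b /= scaler0 add0r.
Qed.

Lemma derive_fst f (p : V * V) v :
  'D_(v, 0) (uncurried f) p = 'D_v (fun x => f x p.2 : R^o) p.1.
Proof.
case: p => x y; rewrite /derive; set a := (fun h : R => _); set b := (fun h : R => _).
suff -> : a = b by [].
by apply/funext => h; rewrite /a /b /= scaler0 add0r.
Qed.

Variable U : set (V * V).
Hypothesis openU : open U.

Lemma smooth_on_dy f A : smooth_on U (uncurried f) -> smooth_on U (uncurried (dy A f)).
Proof.
move=> sf; apply: (smooth_on_eq openU _ (smooth_on_derive (0, delta_mx 0 A) sf)).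
by move=> p _; rewrite derive_snd.
Qed.

Lemma smooth_on_dx f A : smooth_on U (uncurried f) -> smooth_on U (uncurried (dx A f)).
Proof.
move=> sf; apply: (smooth_on_eq openU _ (smooth_on_derive (delta_mx 0 A, 0) sf)).
by move=> p _; rewrite derive_fst.
Qed.

Lemma smooth_on_coord2 A : smooth_on U (fun p => p.2 0 A : R^o).
Proof.
have D (p v : V * V) : is_derive p v (fun p : V * V => p.2 0 A : R^o) (v.2 0 A).
  apply/is_derive_lineP.
  rewrite (_ : (fun h : R => _) = (fun h : R => h * v.2 0 A + p.2 0 A)); last first.
    by apply/funext => h; rewrite /= !mxE.
  by apply: is_derive_eq; rewrite /GRing.scale /=; ring.
apply: smooth_onI => // [p _|v].
  apply: (@differentiable_comp _ _ _ _ (fun p : V * V => p.2) (fun y : V => y 0 A : R^o)).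
    apply: linear_differentiable => q; exact: cvg_snd.
  exact: differentiable_coord.
by apply: (smooth_on_eq openU _ (smooth_on_cst openU (v.2 0 A))) => p _; rewrite derive_val.
Qed.

Hypothesis smoothF : smooth_on U (uncurried F).
Hypothesis posdefF : forall p, U p -> posdef (fundamental_tensor (F p.1) p.2).

Lemma smooth_on_sqf : smooth_on U (uncurried (sqf F)).
Proof. exact: smooth_onX. Qed.

Lemma smooth_on_spray C : smooth_on U (uncurried (spray F C)).
Proof.
apply: smooth_onZ => //; apply: smooth_on_sum => // A; apply: smooth_onM => //.
  apply: (@smooth_on_invmx _ _ _ openU _ (fun p => fundamental_tensor (F p.1) p.2)).
    move=> A' B'; apply: (smooth_on_eq openU (g := fun p =>
      2^-1 * dy B' (dy A' (sqf F)) p.1 p.2)) => [p _|]; first by rewrite mxE.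
    by apply: smooth_onZ => //; do 2 apply: smooth_on_dy; exact: smooth_on_sqf.
  by move=> p /posdefF /posdef_unitmx.
apply: smooth_onB => //; last exact/smooth_on_dx/smooth_on_sqf.
apply: smooth_on_sum => // B; apply: smooth_onM => //; last exact: smooth_on_coord2.
exact/smooth_on_dx/smooth_on_dy/smooth_on_sqf.
Qed.

(** The Douglas curvature consists of the third derivatives of these functions in y.
    They differ from the spray coefficients by a common multiple of y, so the minors
    T^A y^B - T^B y^A are those of the spray. *)
Definition projective_spray A x y : R :=
  spray F A x y - n.+2%:R^-1 * (\sum_(E < n.+1) dy E (spray F E) x y) * y 0 A.

Lemma douglas_curvatureE A B C D x y : douglas_curvature F A B C D x y =
  foldr (fun v (g : V -> R^o) q => 'D_v g q) (projective_spray A x)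
    [:: delta_mx 0 D; delta_mx 0 C; delta_mx 0 B] y.
Proof. by []. Qed.

Lemma smooth_on_projective_spray A : smooth_on U (uncurried (projective_spray A)).
Proof.
apply: smooth_onB => //; first exact: smooth_on_spray.
apply: smooth_onM => //; last exact: smooth_on_coord2.
apply: smooth_onZ => //; apply: smooth_on_sum => // E.
exact/smooth_on_dy/smooth_on_spray.
Qed.

Lemma smooth_on_douglas A B C D : smooth_on U (uncurried (douglas_curvature F A B C D)).
Proof.
by do 3 apply: smooth_on_dy; exact: smooth_on_projective_spray.
Qed.

End SmoothSpray.

Section FinslerSpray.
Variables (R : realType) (n : nat) (rho : R).
Variable F : 'rV[R]_n.+1 -> 'rV[R]_n.+1 -> R.
Local Notation V := 'rV[R]_n.+1.
Hypothesis finslerF : finsler_metric (cylinder rho) F.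

Lemma finsler_posdef p : slit rho p -> posdef (fundamental_tensor (F p.1) p.2).
Proof. by move=> [cx y0]; have [_ _ _ _] := finslerF.2 p.1 cx; apply. Qed.

Lemma quadratic_along_line A (i : 'I_n.+1) x y : cylinder rho x ->
  (forall t, y + t *: delta_mx 0 i != 0) ->
  (forall y, y != 0 -> douglas_curvature F A i i i x y = 0) ->
  exists a b c, forall t, projective_spray F A x (y + t *: delta_mx 0 i) = a + b * t + c * t ^+ 2.
Proof.
move=> cx y0 D0; set e := delta_mx 0 i in y0 *.
pose T := projective_spray F A.
have oU := @open_slit R n rho.
have sT : smooth_on (slit rho) (fun p : V * V => T p.1 p.2 : R^o).
  exact: smooth_on_projective_spray oU finslerF.1 finsler_posdef A.
have line f : smooth_on (slit rho) (fun p : V * V => f p.1 p.2 : R^o) ->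
    forall t : R, is_derive t (1 : R) (fun t : R => f x (y + t *: e) : R) (dy i f x (y + t *: e)).
  move=> sf t; apply: is_derive_line.
  have /(@diff_derivable _ _ _ _ _ (0, e)) : differentiable
    (fun p : V * V => f p.1 p.2 : R^o) (x, y + t *: e).
    by apply: (smooth_on_differentiable sf); split; [exact: cx|exact: y0].
  by move=> /derivable1P d; apply/derivable1P; move: d => /=; under eq_fun do rewrite scaler0 add0r.
have s1 := smooth_on_dy oU i sT; have s2 := smooth_on_dy oU i s1.
have H2 (t : R) : is_derive t (1 : R)
    (fun t : R => dy i (dy i T) x (y + t *: e) : R) 0.
  by rewrite -(D0 (y + t *: e) (y0 t)); exact: line.
exists (T x (y + 0 *: e)), (dy i T x (y + 0 *: e)), (dy i (dy i T) x (y + 0 *: e) / 2).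
exact: third_derivative0_quadratic (line _ sT) (line _ s1) H2.
Qed.

End FinslerSpray.

(** * Vanishing Douglas curvature forces a polynomial spray *)

Section DouglasImpliesPolynomialSpray.
Variables (R : realType) (n : nat) (rho : R).
Variable F : 'rV[R]_n.+1 -> 'rV[R]_n.+1 -> R.
Variable psi : R^o * R^o -> R^o.
Variables i1 i2 : 'I_n.
Local Notation V := 'rV[R]_n.+1.
Local Notation E0 := (delta_mx 0 ord0 : V).
Local Notation e := (fun i => delta_mx 0 (lift ord0 i) : V).
Hypothesis i12 : i1 != i2.
Hypothesis finslerF : finsler_metric (cylinder rho) F.
Hypothesis psi_smooth : smooth_on (strip rho) psi.
Hypothesis F_psi : forall x y, cylinder rho x -> bar y != 0 ->
  F x y = enorm (bar y) * psi (zcoord y, rcoord x).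
Implicit Types (x y v w : V).

Variable r : R.
Hypothesis r_range : 0 < r < rho.

Let x0 : V := r *: e i1.
Let vec s a c : V := s *: E0 + (a *: e i1 + c *: e i2).

Let i21 : i2 != i1. Proof. by rewrite eq_sym. Qed.

Let vec0 s a c : vec s a c 0 ord0 = s.
Proof. by rewrite !mxE !eqxx /=; ring. Qed.
Let vec1 s a c : vec s a c 0 (lift ord0 i1) = a.
Proof. by rewrite !mxE !eqxx !(inj_eq lift_inj) ?eqxx (negbTE i12) /=; ring. Qed.
Let vec2 s a c : vec s a c 0 (lift ord0 i2) = c.
Proof. by rewrite !mxE !eqxx !(inj_eq lift_inj) ?eqxx (negbTE i21) /=; ring. Qed.

Let bdot_vec s a c : bdot (vec s a c) (vec s a c) = a ^+ 2 + c ^+ 2.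
Proof.
rewrite {2}/vec !bdot_linr bdot_delta0 bdotZr !bdot_delta vec1 vec2; ring.
Qed.

Let bdot_x0 s a c : bdot x0 (vec s a c) = r * a.
Proof. by rewrite bdotZl bdotC bdot_delta vec1. Qed.

Let cx0 : cylinder rho x0.
Proof.
case/andP: r_range => r0 rr.
by rewrite /cylinder /= -[enorm _]/(rcoord _) rcoord_e gtr0_norm.
Qed.

Let rx0 : rcoord x0 = r.
Proof. by case/andP: r_range => r0 _; rewrite rcoord_e gtr0_norm. Qed.

Let bx0 : bar x0 != 0.
Proof. by rewrite -bdot_eq0 -sqr_enorm -[enorm _]/(rcoord _) rx0 sqrf_eq0 gt_eqF //; case/andP: r_range. Qed.

Local Notation q := (fun z => spray_radial psi (z, r)).
Local Notation eps := (fun z => spray_axial psi (z, r)).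
Local Notation T := (fun A => projective_spray F A x0).

Let spray_vec s a c u : 0 < u -> u ^+ 2 = a ^+ 2 + c ^+ 2 ->
  T (lift ord0 i1) (vec s a c) * c - T (lift ord0 i2) (vec s a c) * a =
    r * u ^+ 2 * q (s / u) * c /\
  T ord0 (vec s a c) * c - T (lift ord0 i2) (vec s a c) * s =
    r * a * u * eps (s / u) * c.
Proof.
move=> u0 ue; set y := vec s a c.
have uy : enorm (bar y) = u.
  by rewrite enorm_bdot bdot_vec -ue sqrtr_sqr gtr0_norm.
have y0 : bar y != 0 by rewrite -bdot_eq0 -sqr_enorm uy sqrf_eq0 gt_eqF.
have zy : zcoord y = s / u by rewrite /zcoord uy vec0.
rewrite /projective_spray !(spray_sphericalE i12 finslerF psi_smooth F_psi) //.
set N := n.+2%:R^-1 * _.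
rewrite /spray_vector zy rx0 uy bdot_x0.
have xA0 : x0 0 ord0 = 0 by rewrite !mxE /= mulr0.
have xA1 : x0 0 (lift ord0 i1) = r by rewrite !mxE !eqxx mulr1.
have xA2 : x0 0 (lift ord0 i2) = 0.
  by rewrite !mxE !(inj_eq lift_inj) ?eqxx (negbTE i21) mulr0.
have E i : E0 0 (lift ord0 i) = 0 by rewrite mxE.
have E00 : E0 0 ord0 = 1 by rewrite mxE !eqxx.
have add (v w : V) A : (v + w) 0 A = v 0 A + w 0 A by rewrite mxE.
have scale (k : R) (v : V) A : (k *: v) 0 A = k * v 0 A by rewrite mxE.
have := conj (vec0 s a c) (conj (vec1 s a c) (vec2 s a c)); rewrite -/y.
move: N xA0 xA1 xA2; generalize x0 y => X Y N xA0 xA1 xA2 [yA0 [yA1 yA2]].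
rewrite !add !scale !add !scale !E E00 xA0 xA1 xA2 yA0 yA1 yA2.
by split; ring.
Qed.

Hypothesis douglas0 : forall A i y, y != 0 -> douglas_curvature F A i i i x0 y = 0.

(** The minors of the projective spray give q and eps without P. Along the line
    y = (t, e1 + e2) they are polynomial, so q is quadratic and eps cubic in z. Along
    y = (1, t e1 + e2), where u = sqrt (1 + t^2), the minors are polynomials in t of
    known parity, while q and eps enter through u^2 q (1 / u) and u eps (1 / u). As u
    is not a polynomial in t, only q = a z^2 + b and eps = d z are left. *)
Lemma douglas0_spray_polynomial : exists a b d : R, forall z,
  spray_radial psi (z, r) = a * z ^+ 2 + b /\ spray_axial psi (z, r) = d * z.
Proof.
have r0 : 0 < r by case/andP: r_range.
have quad1 A : exists a b c, forall t, T A (vec t 1 1) = a + b * t + c * t ^+ 2.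
  have vecE t : vec 0 1 1 + t *: E0 = vec t 1 1.
    by rewrite /vec scale0r add0r addrC.
  have [t||a [b [c H]]] := @quadratic_along_line R n rho F finslerF A ord0 x0 (vec 0 1 1) cx0.
  - rewrite vecE; apply: bar_neq0_neq0.
    by rewrite -bdot_eq0 bdot_vec expr1n gt_eqF // addr_gt0.
  - by move=> y; exact: douglas0.
  - by exists a, b, c => t; rewrite -vecE H.
have quad2 A : exists a b c, forall t, T A (vec 1 t 1) = a + b * t + c * t ^+ 2.
  have vecE t : vec 1 0 1 + t *: e i1 = vec 1 t 1.
    by rewrite /vec scale0r add0r -addrA [X in _ + X]addrC.
  have [t||a [b [c H]]] := @quadratic_along_line R n rho F finslerF A (lift ord0 i1) x0 (vec 1 0 1) cx0.
  - rewrite vecE; apply: bar_neq0_neq0.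
    by rewrite -bdot_eq0 bdot_vec gt_eqF // expr1n ltr_wpDl // sqr_ge0.
  - by move=> y; exact: douglas0.
  - by exists a, b, c => t; rewrite -vecE H.
pose k := Num.sqrt 2 : R.
have k0 : 0 < k by rewrite sqrtr_gt0.
have kk : k ^+ 2 = 1 ^+ 2 + 1 ^+ 2 :> R by rewrite sqr_sqrtr // expr1n.
have [q0 [q1 [q2 Hq]]] : exists q0 q1 q2, forall z, q z = q0 + q1 * z + q2 * z ^+ 2.
  have [a1 [b1 [c1 H1]]] := quad1 (lift ord0 i1).
  have [a2 [b2 [c2 H2]]] := quad1 (lift ord0 i2).
  exists ((a1 - a2) / (r * k ^+ 2)), ((b1 - b2) * k / (r * k ^+ 2)), ((c1 - c2) / r) => z.
  have [+ _] := @spray_vec (z * k) 1 1 k k0 kk.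
  rewrite H1 H2 mulfK ?gt_eqF // => E.
  apply: (@mulfI _ (r * k ^+ 2)); first by rewrite mulf_neq0 ?gt_eqF // exprn_gt0.
  rewrite -[LHS]mulr1 -E; field.
  by rewrite !gt_eqF.
have [e0 [e1 [e2 [e3 He]]]] : exists e0 e1 e2 e3, forall z,
    eps z = e0 + e1 * z + e2 * z ^+ 2 + e3 * z ^+ 3.
  have [a1 [b1 [c1 H1]]] := quad1 ord0.
  have [a2 [b2 [c2 H2]]] := quad1 (lift ord0 i2).
  exists (a1 / (r * k)), ((b1 - a2) / r), ((c1 - b2) * k / r), (- c2 * k ^+ 2 / r) => z.
  have [_] := @spray_vec (z * k) 1 1 k k0 kk.
  rewrite H1 H2 mulfK ?gt_eqF // !mulr1 => E.
  apply: (@mulfI _ (r * k)); first by rewrite mulf_neq0 ?gt_eqF.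
  rewrite -E; field.
  by rewrite !gt_eqF.
have Hu t u : 0 < u -> u ^+ 2 = t ^+ 2 + 1 ^+ 2 ->
    T (lift ord0 i1) (vec 1 t 1) - T (lift ord0 i2) (vec 1 t 1) * t =
      r * (q0 * u ^+ 2 + q1 * u + q2) /\
    u ^+ 2 * (T ord0 (vec 1 t 1) - T (lift ord0 i2) (vec 1 t 1)) =
      r * t * (e0 * u ^+ 3 + e1 * u ^+ 2 + e2 * u + e3).
  move=> u0 ut; have := spray_vec 1 u0 ut.
  rewrite !mulr1 Hq He => -[-> ->].
  by split; field; rewrite gt_eqF.
have [a0 [b0 [c0 H0]]] := quad2 ord0.
have [a1 [b1 [c1 H1]]] := quad2 (lift ord0 i1).
have [a2 [b2 [c2 H2]]] := quad2 (lift ord0 i2).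
have Ha t u : 0 < u -> u ^+ 2 = t ^+ 2 + 1 ^+ 2 ->
    r * (q0 * u ^+ 2 + q1 * u + q2) = a1 + (c1 - b2) * t ^+ 2.
  move=> u0 ut; have [E1 _] := Hu t u u0 ut.
  (* Adding the values at t and - t keeps the even part. *)
  have [|E2 _] := Hu (- t) u u0; first by rewrite sqrrN.
  move: E1 E2; rewrite H1 H2 H1 H2; lra.
have Hb t u : 0 < u -> u ^+ 2 = t ^+ 2 + 1 ^+ 2 -> t != 0 ->
    r * (e0 * u ^+ 3 + e1 * u ^+ 2 + e2 * u + e3) = (b0 - b2) * u ^+ 2.
  move=> u0 ut t0; have [_ E1] := Hu t u u0 ut.
  (* Subtracting the values at t and - t keeps the odd part. *)
  have [|_ E2] := Hu (- t) u u0; first by rewrite sqrrN.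
  apply: (mulIf t0); move: E1 E2; rewrite H0 H2 H0 H2; lra.
(* Pythagorean triples make u rational; in each family the points suffice to determine a polynomial in u. *)
have A1 := @Ha 0 1 ltr01 ltac:(by field).
have A2 := @Ha (3 / 4) (5 / 4) ltac:(by lra) ltac:(by field).
have A3 := @Ha (4 / 3) (5 / 3) ltac:(by lra) ltac:(by field).
have B1 := @Hb (3 / 4) (5 / 4) ltac:(by lra) ltac:(by field) ltac:(by lra).
have B2 := @Hb (4 / 3) (5 / 3) ltac:(by lra) ltac:(by field) ltac:(by lra).
have B3 := @Hb (5 / 12) (13 / 12) ltac:(by lra) ltac:(by field) ltac:(by lra).
have B4 := @Hb (12 / 5) (13 / 5) ltac:(by lra) ltac:(by field) ltac:(by lra).
have rq1 : r * q1 = 0 by lra.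
have re0 : r * e0 = 0 by lra.
have re2 : r * e2 = 0 by lra.
have re3 : r * e3 = 0 by lra.
have z0 s : r * s = 0 -> s = 0.
  by move/eqP; rewrite mulf_eq0 (gt_eqF r0) => /eqP.
exists q2, q0, e1 => z; rewrite Hq He (z0 _ rq1) (z0 _ re0) (z0 _ re2) (z0 _ re3).
by split; ring.
Qed.

End DouglasImpliesPolynomialSpray.

(** * Evolution of the profile in the radius *)

Section RandersProfileODE.
Variable R : realType.

Lemma is_derive_sqrt_quadratic (g t : R) : 0 < g ->
  is_derive t (1 : R) (fun t : R => Num.sqrt (1 + g * t ^+ 2) : R)
    (g * t / Num.sqrt (1 + g * t ^+ 2)).
Proof.
move=> g0; have s0 : 0 < 1 + g * t ^+ 2 by rewrite ltr_pwDl // mulr_ge0 ?sqr_ge0 // ltW.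
have d : is_derive t (1 : R) (fun t : R => 1 + g * t ^+ 2 : R) (2 * g * t).
  by apply: is_derive_eq; rewrite /GRing.scale /=; ring.
apply: is_derive_eq (is_derive_chain d (is_derive1_sqrt s0)) _.
by field; rewrite gt_eqF // sqrtr_gt0.
Qed.

(** For m = f - z f1 we have m' = - z f2, so the equation makes m^2 (z^2 - k) a first
    integral. This gives m, then f2 = m / (z^2 - k), and two integrations give f. *)
Lemma randers_profile_ode (f f1 f2 : R -> R) (k : R) :
  (forall z : R, is_derive z (1 : R) f (f1 z)) ->
  (forall z : R, is_derive z (1 : R) f1 (f2 z)) ->
  (forall z, 0 < f z - z * f1 z) -> (forall z, 0 < f2 z) ->
  (forall z, (z ^+ 2 - k) * f2 z = f z - z * f1 z) ->
  exists2 g, 0 < g & forall z,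
    f z = f 0 * Num.sqrt (1 + g * z ^+ 2) + f1 0 * z /\
    f z - z * f1 z = f 0 / Num.sqrt (1 + g * z ^+ 2).
Proof.
move=> fd f1d m0 f20 ode.
have f00 : 0 < f 0 by have := m0 0; rewrite mul0r subr0.
have k0 : k < 0.
  have := ode 0; rewrite expr0n /= sub0r mul0r subr0 => E.
  by rewrite -oppr_gt0 -(pmulr_lgt0 _ (f20 0)) E.
have md (z : R) : is_derive z (1 : R) (fun z => f z - z * f1 z : R) (- z * f2 z).
  apply: is_derive_eq (is_derive_sub (fd z) (is_derive_mul (is_derive_id _ _) (f1d z))) _.
  by rewrite /=; ring.
have energy z : (f z - z * f1 z) ^+ 2 * (z ^+ 2 - k) = f 0 ^+ 2 * - k.
  have D (t : R) : is_derive t (1 : R)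
      (fun t => (f t - t * f1 t) * (f t - t * f1 t) * (t * t - k) : R) 0.
    apply: is_derive_eq (is_derive_mul (is_derive_mul (md t) (md t))
      (is_derive_sub (is_derive_mul (is_derive_id _ _) (is_derive_id _ _)) (is_derive_const k _ _))) _.
    rewrite /=; have := ode t; set m := f t - _ => <-; ring.
  have := derive0_constantT D z 0; rewrite !expr2 => ->.
  by rewrite !mul0r !subr0 sub0r.
exists (- k^-1); first by rewrite oppr_gt0 invr_lt0.
set g := - k^-1; have g0 : 0 < g by rewrite oppr_gt0 invr_lt0.
have kne : k != 0 by rewrite lt_eqF.
pose S z := Num.sqrt (1 + g * z ^+ 2).
have s0 z : 0 < 1 + g * z ^+ 2 by rewrite ltr_pwDl // mulr_ge0 ?sqr_ge0 // ltW.
have S0 z : 0 < S z by rewrite sqrtr_gt0.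
have SS z : S z ^+ 2 = 1 + g * z ^+ 2 by rewrite sqr_sqrtr // ltW.
have mE z : f z - z * f1 z = f 0 / S z.
  apply: (@mulIf _ (S z)); first by rewrite gt_eqF.
  rewrite divfK ?gt_eqF //; apply/eqP.
  rewrite -(@eqrXn2 _ 2) // ?mulr_ge0 ?ltW // exprMn SS.
  apply/eqP/(@mulIf _ (- k)); first by rewrite oppr_eq0.
  by rewrite -(energy z) /g; field.
have f2E z : f2 z = f 0 * (g / S z ^+ 3).
  have zk0 : z ^+ 2 - k != 0 by rewrite gt_eqF // subr_gt0 (lt_le_trans k0) // sqr_ge0.
  apply: (mulfI zk0); rewrite ode mE.
  have -> : z ^+ 2 - k = S z ^+ 2 / g by rewrite SS /g; field.
  by field; rewrite !gt_eqF.
have Sd (z : R) : is_derive z (1 : R) S (g * z / S z) by exact: is_derive_sqrt_quadratic.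
have S1d (z : R) : is_derive z (1 : R) (fun z => g * z / S z : R) (g / S z ^+ 3).
  apply: is_derive_eq (is_derive_mul (is_derive_cmul g (is_derive_id _ _))
    (is_derive_inv _ (Sd z))) _; first by rewrite gt_eqF.
  rewrite /=; have -> : g * z * (- (g * z / S z) / S z ^+ 2) + (S z)^-1 * (g * 1) =
    g * (S z ^+ 2 - g * z ^+ 2) / S z ^+ 3 by field; rewrite gt_eqF.
  by rewrite SS addrK mulr1.
have f1E z : f1 z = f1 0 + f 0 * (g * z / S z).
  have H (t : R) : is_derive t (1 : R) (fun z => f 0 * (g * z / S z) : R) (f2 t).
    by rewrite f2E; exact: is_derive_cmul.
  by rewrite (derive_eq_constantT f1d H z) mulr0 mul0r mulr0 subr0.
move=> z; rewrite -/(S z); split=> //.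
by apply/eqP; rewrite -subr_eq0 -(subrK (z * f1 z) (f z)) mE f1E; apply/eqP;
  rewrite -{1}[f 0]mulr1 -[X in f 0 * X / _](addrK (g * z ^+ 2)) -SS; field; rewrite gt_eqF.
Qed.

End RandersProfileODE.

Section Evolution.
Variables (R : realType) (rho : R).
Variable psi : R^o * R^o -> R^o.
Hypothesis psi_smooth : smooth_on (strip rho) psi.

Lemma is_derive_curve (g : R^o * R^o -> R^o) (c : R -> R) (r dc : R) :
  smooth_on (strip rho) g -> `|r| < rho -> is_derive r (1 : R) c dc ->
  is_derive r (1 : R) (fun s : R => g (c s, s) : R) (dc * dz g (c r, r) + dr g (c r, r)).
Proof.
move=> sg rr [cd <-].
have dc' : differentiable (c : R^o -> R^o) r by exact/derivable1_diffP.
have dg : differentiable g (c r, r) by exact: smooth_on_differentiable sg _.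
have dp : differentiable (fun s : R^o => (c s, s) : R^o * R^o) r.
  by apply: differentiable_pair.
have dgp : differentiable (g \o (fun s : R^o => (c s, s) : R^o * R^o)) r.
  exact: differentiable_comp.
apply: DeriveDef; first exact/derivable1_diffP.
rewrite -[LHS]/('D_1 (g \o (fun s : R^o => (c s, s) : R^o * R^o)) r) deriveE //.
rewrite diff_comp //= diff_pair //= -deriveE // -deriveE //.
have -> : 'd (fun s : R^o => s) r 1 = 1 :> R^o by rewrite (@diff_val _ _ _ _ _ id id).
rewrite /dz /dr -derive_lincomb //; congr ('D_ _ _ _).
by apply/pair_equal_spec; split; rewrite /= ?addr0 ?[_ *: _]mulr1 // [_ *: _]mulr0 add0r.
Qed.

(** The homothety of the (z, psi) plane that brings the value at z = 0 to 1. For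
    psi = G (h z) / h it removes the dependence on r altogether. *)
Definition waist r : R := psi (0, r).
Definition normalized t r : R := psi (t * waist r, r) / waist r.

Lemma is_derive_waist r : `|r| < rho -> is_derive r (1 : R) waist (dr psi (0, r)).
Proof. by move=> rr; exact: (is_derive_dr 0 psi_smooth rr). Qed.

Lemma is_derive_normalized t r : `|r| < rho -> waist r != 0 ->
  is_derive r (1 : R) (normalized t)
    (((t * dr psi (0, r)) * dz psi (t * waist r, r) + dr psi (t * waist r, r)) / waist r
     - psi (t * waist r, r) * dr psi (0, r) / waist r ^+ 2).
Proof.
move=> rr f0; have fd := is_derive_waist rr.
apply: is_derive_eq (is_derive_mul (is_derive_curve psi_smooth rr (is_derive_cmul t fd))
  (is_derive_inv f0 fd)) _.
by field.
Qed.

Lemma is_derive_normalized_quadratic t r A B : `|r| < rho -> waist r != 0 ->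
  (forall z, dr psi (z, r) = (A + B * z ^+ 2) * intercept psi (z, r)) ->
  is_derive r (1 : R) (normalized t)
    (B * t ^+ 2 * waist r * intercept psi (t * waist r, r)).
Proof.
move=> rr f0 E; apply: is_derive_eq (is_derive_normalized t rr f0) _.
rewrite !E /intercept /= -/(waist r) !mul0r subr0 expr0n /= mulr0 addr0; field.
exact: f0.
Qed.

(** If psi (z, r) = f sqrt (1 + g z^2) + b z, the normalized profile is
    sqrt (1 + g f^2 t^2) + b t, and tilt and spread recover b and g f^2 from its values
    at 1 and -1. The defect then vanishes; conversely it vanishes for all t only on
    profiles of this kind. *)
Definition tilt r : R := (normalized 1 r - normalized (-1) r) / 2.
Definition spread r : R := ((normalized 1 r + normalized (-1) r) / 2) ^+ 2 - 1.
Definition randers_defect t r : R :=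
  (normalized t r - t * tilt r) ^+ 2 - 1 - spread r * t ^+ 2.

(** What a Douglas metric satisfies at each radius: the profile moves with a speed which
    is quadratic in z relative to its intercept, and if the quadratic part is present
    the profile is already of Randers type at that radius. *)
Definition quadratic_evolution r := exists A B : R,
  (forall z, dr psi (z, r) = (A + B * z ^+ 2) * intercept psi (z, r)) /\
  (B != 0 -> exists2 g, 0 < g & exists b, forall z,
     psi (z, r) = waist r * Num.sqrt (1 + g * z ^+ 2) + b * z /\
     intercept psi (z, r) = waist r / Num.sqrt (1 + g * z ^+ 2)).

Lemma normalized_randers r (g b : R) : 0 < g -> 0 < waist r ->
  (forall z, psi (z, r) = waist r * Num.sqrt (1 + g * z ^+ 2) + b * z) ->
  forall t, normalized t r = Num.sqrt (1 + g * waist r ^+ 2 * t ^+ 2) + b * t.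
Proof.
move=> g0 f0 E t; rewrite /normalized E.
rewrite (_ : g * (t * waist r) ^+ 2 = g * waist r ^+ 2 * t ^+ 2); last by ring.
by field; rewrite gt_eqF.
Qed.

Lemma randers_defect0 r (g b : R) : 0 < g -> 0 < waist r ->
  (forall z, psi (z, r) = waist r * Num.sqrt (1 + g * z ^+ 2) + b * z) ->
  forall t, randers_defect t r = 0.
Proof.
move=> g0 f0 /(normalized_randers g0 f0) E t.
rewrite /randers_defect /spread /tilt !E sqrrN expr1n !mulr1.
set G := g * _; have G0 : 0 < G by rewrite mulr_gt0 // exprn_gt0.
set S1 := Num.sqrt (1 + G); set St := Num.sqrt _.
have -> : St + b * t - t * ((S1 + b - (S1 + b * -1)) / 2) = St by field.
have -> : (S1 + b + (S1 + b * -1)) / 2 = S1 by field.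
have -> : S1 ^+ 2 = 1 + G by rewrite sqr_sqrtr // addr_ge0 // ltW.
have -> : St ^+ 2 = 1 + G * t ^+ 2.
  by rewrite sqr_sqrtr // addr_ge0 // mulr_ge0 ?sqr_ge0 // ltW.
ring.
Qed.

(** At a radius where B = 0 the normalized profile is stationary, for all t at once. At a
    radius where B != 0 the profile is of Randers type, and the speed B t^2 waist m is
    tangent to the family of Randers profiles with the same tilt. In both cases the
    defect and the tilt are stationary. *)
Lemma randers_defect_derive t r : `|r| < rho -> 0 < waist r -> quadratic_evolution r ->
  is_derive r (1 : R) (randers_defect t) 0 /\ is_derive r (1 : R) tilt 0.
Proof.
move=> rr f0 [A [B [E H]]].
have [C [EC ED]] : exists C : R -> R,
    (forall t, is_derive r (1 : R) (normalized t) (C t)) /\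
    (C (-1) = C 1 /\ forall t, (normalized t r - t * tilt r) * C t =
      (normalized 1 r + normalized (-1) r) / 2 * C 1 * t ^+ 2).
  exists (fun t => B * t ^+ 2 * waist r * intercept psi (t * waist r, r)); split.
    by move=> s; apply: is_derive_normalized_quadratic; rewrite ?gt_eqF.
  have [->|/H[g g0 [b {}H]]] := eqVneq B 0.
    by split=> [|s]; rewrite !mul0r // !mulr0 mul0r.
  have N := normalized_randers g0 f0 (fun z => (H z).1).
  have I s : intercept psi (s * waist r, r) =
      waist r / Num.sqrt (1 + g * waist r ^+ 2 * s ^+ 2).
    by rewrite (H _).2; congr (_ / Num.sqrt (_ + _)); ring.
  split=> [|s]; first by rewrite !I sqrrN.
  rewrite /tilt !I !N sqrrN expr1n !mulr1.
  set G := g * _; have G0 : 0 < G by rewrite mulr_gt0 // exprn_gt0.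
  set S1 := Num.sqrt (1 + G); set St := Num.sqrt _.
  have S10 : S1 != 0 by rewrite gt_eqF // sqrtr_gt0 addr_gt0.
  have St0 : St != 0 by rewrite gt_eqF // sqrtr_gt0 ltr_pwDl // mulr_ge0 ?sqr_ge0 // ltW.
  by field; rewrite S10 St0.
have [C1 {}ED] := ED.
have Dt : is_derive r (1 : R) tilt 0.
  apply: is_derive_eq (is_derive_mul (is_derive_sub (EC 1) (EC (-1)))
    (is_derive_const (2^-1) _ _)) _.
  by rewrite C1 subrr !mulr0 addr0.
split=> //.
pose avg r := (normalized 1 r + normalized (-1) r) * 2^-1.
have Da : is_derive r (1 : R) avg (C 1).
  apply: is_derive_eq (is_derive_mul (is_derive_add (EC 1) (EC (-1)))
    (is_derive_const (2^-1) _ _)) _.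
  by rewrite C1; field.
have Dc := is_derive_sub (EC t) (is_derive_cmul t Dt).
rewrite (_ : randers_defect t = (fun r => (normalized t r - t * tilt r) * (normalized t r - t * tilt r)
    - 1 - (avg r * avg r - 1) * t ^+ 2)); last first.
  by apply/funext => s; rewrite /randers_defect /spread /avg !expr2.
apply: is_derive_eq (is_derive_sub
  (is_derive_sub (is_derive_mul Dc Dc) (is_derive_const 1 _ _))
  (is_derive_mul (is_derive_sub (is_derive_mul Da Da) (is_derive_const 1 _ _))
    (is_derive_const (t ^+ 2) _ _))) _.
by rewrite !mulr0 !subr0 ED /avg; field.
Qed.

End Evolution.

(** * From the spray to the two families of metrics *)

Section PolynomialSprayEvolution.
Variables (R : realType) (rho : R).
Variable psi : R^o * R^o -> R^o.
Hypothesis psi_smooth : smooth_on (strip rho) psi.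
Variable r : R.
Hypothesis r_range : 0 < r < rho.
Hypothesis intercept0 : forall z, 0 < intercept psi (z, r).
Hypothesis dzz0 : forall z, 0 < dz (dz psi) (z, r).

Let r0 : 0 < r. Proof. by case/andP: r_range. Qed.
Let rr : `|r| < rho. Proof. by case/andP: r_range => _; rewrite gtr0_norm. Qed.

Lemma dr_spray_radial z : dr psi (z, r) = - (2 * r * spray_radial psi (z, r)) * intercept psi (z, r).
Proof. by rewrite /spray_radial /=; field; rewrite !gt_eqF //; exact: intercept0. Qed.

Lemma drdz_spray_axial z : dr (dz psi) (z, r) =
  2 * r * (spray_axial psi (z, r) - z * spray_radial psi (z, r)) * dz (dz psi) (z, r).
Proof.
rewrite /spray_axial /=; move: (spray_radial _ _) => s; field.
by rewrite !gt_eqF //; exact: dzz0.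
Qed.

(** The form of q is the evolution equation. Differentiating it in z and comparing with
    the form of eps, which involves the other mixed derivative, gives
    (d - 2 b - 2 a z^2) psi_zz + 2 a m = 0 with m the intercept. For a != 0 this is the
    differential equation of a Randers profile. *)
Lemma polynomial_spray_evolution :
  (exists a b d : R, forall z,
    spray_radial psi (z, r) = a * z ^+ 2 + b /\ spray_axial psi (z, r) = d * z) ->
  quadratic_evolution psi r.
Proof.
move=> [a [b [d H]]].
have Er z : dr psi (z, r) = (- (2 * r * b) + - (2 * r * a) * z ^+ 2) * intercept psi (z, r).
  by rewrite dr_spray_radial (H z).1; ring.
exists (- (2 * r * b)), (- (2 * r * a)); split=> // a0'.
have a0 : a != 0 by apply: contraNneq a0' => ->; rewrite mulr0 oppr0.
have ode' z : z * ((d - 2 * b - 2 * a * z ^+ 2) * dz (dz psi) (z, r)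
    + 2 * a * intercept psi (z, r)) = 0.
  have D1 := is_derive_dz z (smooth_dr psi_smooth) rr.
  have D2 : is_derive z (1 : R) (fun t : R => dr psi (t, r) : R)
      (- (2 * r) * ((2 * a * z) * intercept psi (z, r) +
         (a * z ^+ 2 + b) * (- z * dz (dz psi) (z, r)))).
    have Dq : is_derive z (1 : R) (fun t : R => - (2 * r * b) + - (2 * r * a) * t ^+ 2 : R)
        (- (2 * r) * (2 * a * z)).
      by apply: is_derive_eq; rewrite /GRing.scale /=; ring.
    rewrite (_ : (fun t : R => _) = (fun t : R =>
      (- (2 * r * b) + - (2 * r * a) * t ^+ 2) * intercept psi (t, r))); last exact/funext.
    apply: is_derive_eq (is_derive_mul Dq (is_derive_intercept_z z psi_smooth rr)) _.
    by ring.
  have : dz (dr psi) (z, r) = dr (dz psi) (z, r) by rewrite (dr_dz psi_smooth).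
  rewrite -(@derive_val _ _ _ _ _ _ _ D1) (@derive_val _ _ _ _ _ _ _ D2).
  rewrite drdz_spray_axial (H z).1 (H z).2 => E.
  have r20 : 2 * r != 0 by rewrite mulf_neq0 // gt_eqF.
  apply: (mulfI r20); rewrite mulr0.
  move/eqP: E; rewrite -subr_eq0 => /eqP E; rewrite -[RHS]oppr0 -E; ring.
pose k := (d - 2 * b) / (2 * a).
have ode z : (z ^+ 2 - k) * dz (dz psi) (z, r) = intercept psi (z, r).
  have nz t : t != 0 -> (t ^+ 2 - k) * dz (dz psi) (t, r) = intercept psi (t, r).
    move=> t0; have /eqP := ode' t; rewrite mulf_eq0 (negbTE t0) /= => /eqP E.
    have a20 : 2 * a != 0 by rewrite mulf_neq0.
    apply: (mulfI a20); rewrite -[LHS]addr0 -[X in _ + X = _]E /k; field.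
    by rewrite a0.
  (* The common factor z was cancelled; z = 0 is recovered by continuity. *)
  have [->|/nz//] := eqVneq z 0.
  apply: (@continuous_right_eq R (fun t : R => (t ^+ 2 - k) * dz (dz psi) (t, r))
    (fun t => intercept psi (t, r)) 0 1) => //.
  - have Dk : is_derive (0 : R) (1 : R) (fun t : R => t ^+ 2 - k : R) 0.
      by apply: is_derive_eq; rewrite /GRing.scale /=; ring.
    have [D _] := is_derive_mul Dk (is_derive_dz 0 (smooth_dz (smooth_dz psi_smooth)) rr).
    exact/differentiable_continuous/derivable1_diffP.
  - have [D _] := is_derive_intercept_z 0 psi_smooth rr.
    exact/differentiable_continuous/derivable1_diffP.
  - by move=> t /andP[t0 _]; apply: nz; rewrite gt_eqF.
have [g g0 {}H] := @randers_profile_ode R (fun z => psi (z, r)) (fun z => dz psi (z, r))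
  (fun z => dz (dz psi) (z, r)) k (fun z => is_derive_dz z psi_smooth rr)
  (fun z => is_derive_dz z (smooth_dz psi_smooth) rr) intercept0 dzz0 ode.
by exists g => //; exists (dz psi (0, r)).
Qed.

End PolynomialSprayEvolution.

Lemma derivable_differentiable_on (R : realType) (f : R -> R) (A : set R) :
  (forall r, A r -> derivable (f : R^o -> R^o) r 1) ->
  differentiable_on (V := R^o) A f.
Proof.
move=> fd p Ap; have /derivable1_diffP/differentiable_linear_approx[L [Lc H]] := fd p Ap.
exists L; split=> // e e0; exact/cvg_within/H.
Qed.

Lemma radii_interval (R : realType) (rho : R) : is_interval [set r : R | 0 < r < rho].
Proof.
move=> a b /andP[a0 ar] /andP[b0 br] c /andP[ac cb].
by rewrite /= (lt_le_trans a0) // (le_lt_trans cb).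
Qed.

Section Dichotomy.
Variables (R : realType) (n : nat) (rho : R).
Variable F : 'rV[R]_n.+1 -> 'rV[R]_n.+1 -> R.
Variable psi : R^o * R^o -> R^o.
Variables i1 i2 : 'I_n.
Local Notation V := 'rV[R]_n.+1.
Local Notation E0 := (delta_mx 0 ord0 : V).
Local Notation e := (fun i => delta_mx 0 (lift ord0 i) : V).
Hypothesis rho0 : 0 < rho.
Hypothesis i12 : i1 != i2.
Hypothesis finslerF : finsler_metric (cylinder rho) F.
Hypothesis psi_smooth : smooth_on (strip rho) psi.
Hypothesis F_psi : forall x y, cylinder rho x -> bar y != 0 ->
  F x y = enorm (bar y) * psi (zcoord y, rcoord x).
Implicit Types (x y v w : V).

Let m0 z r : 0 <= r < rho -> 0 < intercept psi (z, r).
Proof. exact: (intercept_gt0 i12 finslerF psi_smooth F_psi). Qed.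
Let zz0 z r : 0 <= r < rho -> 0 < dz (dz psi) (z, r).
Proof. exact: (dzz_gt0 i12 finslerF psi_smooth F_psi). Qed.
Let f0 r : 0 <= r < rho -> 0 < waist psi r.
Proof. exact: (psi_gt0 i1 i2 finslerF F_psi). Qed.
Let nrm r : 0 <= r < rho -> `|r| < rho.
Proof. by move=> /andP[r0 rr]; rewrite ger0_norm. Qed.
Let rc x : cylinder rho x -> 0 <= rcoord x < rho.
Proof. by move=> cx; rewrite enorm_ge0. Qed.
Let oo_co r : 0 < r < rho -> 0 <= r < rho.
Proof. by move=> /andP[/ltW -> ->]. Qed.
Let J : set R := [set r | 0 < r < rho].
Let J_interval : is_interval J. Proof. exact: radii_interval. Qed.

Lemma normalized_profile z r : 0 <= r < rho ->
  psi (z, r) = waist psi r * normalized psi (z / waist psi r) r.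
Proof.
move=> /f0 fr; rewrite /normalized divfK ?gt_eqF // mulrC divfK // gt_eqF //.
Qed.

Lemma derivable_waist r : 0 <= r < rho -> derivable (waist psi : R^o -> R^o) r 1.
Proof. by move=> rr; have [] := is_derive_waist psi_smooth (nrm rr). Qed.

Lemma is_derive_normalized_z t r : 0 <= r < rho ->
  is_derive t (1 : R) (fun t : R => normalized psi t r : R) (dz psi (t * waist psi r, r)) /\
  is_derive t (1 : R) (fun t : R => dz psi (t * waist psi r, r) : R)
    (waist psi r * dz (dz psi) (t * waist psi r, r)).
Proof.
move=> rr; have fr := f0 rr.
have tf : is_derive t (1 : R) (fun t : R => t * waist psi r : R) (waist psi r).
  by apply: is_derive_eq; rewrite /GRing.scale /=; ring.
split.
  apply: is_derive_eq (is_derive_mul (is_derive_chain tf (is_derive_dz _ psi_smooth (nrm rr)))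
    (is_derive_const (waist psi r)^-1 _ _)) _.
  by field; rewrite gt_eqF.
apply: is_derive_eq (is_derive_chain tf (is_derive_dz _ (smooth_dz psi_smooth) (nrm rr))) _.
by rewrite mulrC.
Qed.

(** If normalized profiles do not change with r, then the metric is determined by one of
    them and by the scale 1 / waist. *)
Lemma scaling_alternative :
  (forall r, J r -> forall t, is_derive r (1 : R) (normalized psi t) 0) ->
  exists h G : R -> R,
     [/\ differentiable_on (V := R^o) [set r | 0 <= r < rho] h,
         forall r : R, 0 <= r < rho -> 0 < h r,
         forall t : R,
           [/\ derivable (G : R^o -> R^o) t 1,
               derivable (derive1 (G : R^o -> R^o)) t 1 & 0 < G t],
         forall t : R,
           0 < G t - t * derive1 (G : R^o -> R^o) t /\
           0 < derive1 (derive1 (G : R^o -> R^o)) t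
       & forall x y : V, cylinder rho x -> bar x != 0 -> bar y != 0 ->
           F x y = enorm (bar y) * (h (rcoord x))^-1 * G (h (rcoord x) * zcoord y)].
Proof.
move=> dN; pose s := rho / 2.
have Js : J s by rewrite /J /= /s divr_gt0 //= ltr_pdivrMr // ltr_pMr // ltr1n.
have ss := oo_co Js; have fs := f0 ss.
pose G t := normalized psi t s.
have dG t := (is_derive_normalized_z t ss).1.
have dG' t := (is_derive_normalized_z t ss).2.
have G1 : derive1 (G : R^o -> R^o) = fun t => dz psi (t * waist psi s, s).
  by apply/funext => t; rewrite derive1E; exact: (@derive_val _ _ _ _ _ _ _ (dG t)).
have G2 t : derive1 (derive1 (G : R^o -> R^o)) t = waist psi s * dz (dz psi) (t * waist psi s, s).
  by rewrite G1 derive1E; exact: (@derive_val _ _ _ _ _ _ _ (dG' t)).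
exists (fun r => (waist psi r)^-1), G; split.
- apply: derivable_differentiable_on => r rr.
  have [] // := @is_derive_inv _ _ (waist psi) r 1 _ _ (is_derive_waist psi_smooth (nrm rr)).
  by rewrite gt_eqF // f0.
- by move=> r rr; rewrite invr_gt0 f0.
- move=> t; split; first by have [] := dG t.
    by rewrite G1; have [] := dG' t.
  by rewrite divr_gt0 // (psi_gt0 i1 i2 finslerF F_psi).
- move=> t; rewrite G2 G1 mulr_gt0 // ?zz0 //; split=> //.
  have := m0 (t * waist psi s) ss; rewrite /intercept /= /G /normalized => H.
  have -> : psi (t * waist psi s, s) / waist psi s - t * dz psi (t * waist psi s, s) =
     (psi (t * waist psi s, s) - t * waist psi s * dz psi (t * waist psi s, s)) / waist psi s.
    by field; rewrite gt_eqF.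
  by rewrite divr_gt0.
- move=> x y cx x0 y0; rewrite F_psi // invrK -mulrA; congr (_ * _).
  have rx := rc cx; rewrite normalized_profile // [_^-1 * _]mulrC; congr (_ * _).
  apply: (@derive0_constant R (normalized psi (zcoord y / waist psi (rcoord x))) J) => //.
    by move=> t Jt; exact: dN.
  by case/andP: rx => _ rr; rewrite /J /= rr andbT; exact: enorm_gt0.
Qed.

Section RandersAlternative.
Variable b : R.
Hypothesis tilt_b : forall r, 0 <= r < rho -> tilt psi r = b.
Hypothesis defect0 : forall t r, 0 <= r < rho -> randers_defect psi t r = 0.

Let f := waist psi.
Let g r := spread psi r / waist psi r ^+ 2.

(** With c (t) = normalized t - b t, the vanishing defect reads c^2 = 1 + spread t^2.
    Strict convexity gives the sign of spread (second derivative at 0), and positivity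
    of the intercept selects the positive square root. *)
Lemma spread_normalized r : 0 <= r < rho -> 0 < spread psi r /\
  forall t, normalized psi t r = Num.sqrt (1 + spread psi r * t ^+ 2) + b * t.
Proof.
move=> rr; have fr := f0 rr; set G := spread psi r.
pose c t := normalized psi t r - b * t; pose c1 t := dz psi (t * waist psi r, r) - b.
have cc t : c t * c t = 1 + G * t ^+ 2.
  have := defect0 t rr; rewrite /randers_defect tilt_b // mulrC expr2 -/(c t) -/G => E.
  by apply/eqP; rewrite -subr_eq0 opprD addrA E.
have dc (t : R) : is_derive t (1 : R) c (c1 t).
  apply: is_derive_eq (is_derive_sub (is_derive_normalized_z t rr).1
    (is_derive_cmul b (is_derive_id _ _))) _.
  by rewrite mulr1.
have dc1 (t : R) : is_derive t (1 : R) c1 (waist psi r * dz (dz psi) (t * waist psi r, r)).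
  apply: is_derive_eq (is_derive_sub (is_derive_normalized_z t rr).2 (is_derive_const b _ _)) _.
  by rewrite subr0.
have cc1 t : c t * c1 t = G * t.
  have D1 := is_derive_mul (dc t) (dc t).
  have D2 : is_derive t (1 : R) (fun t => c t * c t : R) (2 * (G * t)).
    rewrite (_ : (fun t => _) = (fun t => 1 + G * t ^+ 2)); last exact/funext.
    by apply: is_derive_eq; rewrite /GRing.scale /=; ring.
  have := @derive_val _ _ _ _ _ _ _ D1; rewrite (@derive_val _ _ _ _ _ _ _ D2) => E.
  by apply: (@mulfI _ 2) => //; rewrite E; ring.
have cpos t : 0 < c t.
  have M : 0 < c t - t * c1 t.
    have := m0 (t * waist psi r) rr; rewrite /intercept /= => M.
    rewrite /c /c1 /normalized.
    have -> : psi (t * waist psi r, r) / waist psi r - b * t -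
        t * (dz psi (t * waist psi r, r) - b) =
      (psi (t * waist psi r, r) - t * waist psi r * dz psi (t * waist psi r, r)) / waist psi r.
      by field; rewrite gt_eqF.
    by rewrite divr_gt0.
  rewrite -(pmulr_lgt0 _ M) mulrBr cc (mulrCA (c t)) cc1.
  by rewrite (_ : _ - _ = 1) //; ring.
have c0 : c 0 = 1.
  by rewrite /c /normalized mul0r mulr0 subr0 divff // gt_eqF.
have Gpos : 0 < G.
  have D1 := is_derive_mul (dc 0) (dc1 0).
  have D2 : is_derive (0 : R) (1 : R) (fun t => c t * c1 t : R) G.
    rewrite (_ : (fun t => _) = (fun t => G * t)); last exact/funext.
    by apply: is_derive_eq; rewrite /GRing.scale /=; ring.
  have := @derive_val _ _ _ _ _ _ _ D1; rewrite (@derive_val _ _ _ _ _ _ _ D2) => ->.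
  rewrite c0 mul1r ltr_pwDl ?mulr_gt0 ?zz0 // -expr2 sqr_ge0 //.
split=> // t; rewrite -cc -expr2 sqrtr_sqr gtr0_norm // /c subrK //.
Qed.

Lemma randers_g_gt0 r : 0 <= r < rho -> 0 < g r.
Proof. by move=> rr; rewrite divr_gt0 ?exprn_gt0 ?f0 //; have [] := spread_normalized rr. Qed.

(** On the axis bar y = 0 the profile is not available; there the formula is the limit
    along y + t e2. *)
Lemma randers_formula x y : cylinder rho x ->
  F x y = f (rcoord x) *
    Num.sqrt (g (rcoord x) * y 0 ord0 ^+ 2 + enorm (bar y) ^+ 2) + b * y 0 ord0.
Proof.
move=> cx; have rr := rc cx; set r := rcoord x in rr *.
have fr := f0 rr; have [G0 N] := spread_normalized rr.
have generic w : bar w != 0 -> F x w =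
    f r * Num.sqrt (g r * w 0 ord0 ^+ 2 + enorm (bar w) ^+ 2) + b * w 0 ord0.
  move=> w0; have u0 := enorm_gt0 w0.
  rewrite F_psi // normalized_profile // N -/r.
  have -> : g r * w 0 ord0 ^+ 2 + enorm (bar w) ^+ 2 =
      enorm (bar w) ^+ 2 * (1 + spread psi r * (zcoord w / waist psi r) ^+ 2).
    by rewrite /g /zcoord; field; rewrite !gt_eqF.
  rewrite sqrtrM ?sqr_ge0 // sqrtr_sqr gtr0_norm // /zcoord /f.
  move: (Num.sqrt _) => S; field.
  by rewrite !gt_eqF.
have [y0|] := eqVneq (bar y) 0; last exact: generic.
have [s0|s0] := eqVneq (y 0 ord0) 0.
  have -> : y = 0.
    apply/rowP => j; rewrite mxE; case: (unliftP ord0 j) => [k ->|-> //].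
    by rewrite -barE y0 mxE.
  have [_ F00 _ _ _] := finslerF.2 x cx.
  rewrite (F00 0).2 // mxE expr0n !mulr0 /= add0r addr0.
  have -> : enorm (bar (0 : V)) = 0.
    by rewrite -(scale0r (0 : V)) enormZ normr0 mul0r.
  by rewrite expr0n sqrtr0 mulr0.
have yn0 : y != 0 by apply: contraNneq s0 => ->; rewrite mxE.
have ybar t : bar (y + t *: e i2) = bar (t *: e i2).
  by rewrite addrC bar_lin y0 addr0; apply/rowP => i; rewrite !mxE.
have yt0 t : (y + t *: e i2) 0 ord0 = y 0 ord0 by rewrite !mxE /= mulr0 addr0.
have := @continuous_right_eq R (fun t => F (x + t *: 0) (y + t *: e i2))
  (fun t => f r * Num.sqrt (g r * y 0 ord0 ^+ 2 + t ^+ 2) + b * y 0 ord0) 0 1 ltr01.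
rewrite !scale0r !addr0 y0.
have -> : enorm (0 : 'rV[R]_n) = 0.
  by rewrite /enorm big1 ?sqrtr0 // => i _; rewrite mxE expr0n.
apply.
- by apply: (continuous_F_line finslerF); rewrite scale0r addr0.
- apply: cvgD; last exact: cvg_cst.
  apply: cvgM; first exact: cvg_cst.
  apply: (@continuous_comp _ _ _ (fun t : R => g r * y 0 ord0 ^+ 2 + t ^+ 2) Num.sqrt); last exact: sqrt_continuous.
  by apply: cvgD; [exact: cvg_cst|exact: exprn_continuous].
- move=> t /andP[t0 _].
  have yt : bar (y + t *: e i2) != 0.
    by rewrite -bdot_eq0 -sqr_enorm ybar enormZ enorm_e mulr1 gtr0_norm // sqrf_eq0 gt_eqF.
  by rewrite scaler0 addr0 generic // yt0 ybar enormZ enorm_e mulr1 gtr0_norm.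
Qed.

(** Positivity of F on the two axial directions. *)
Lemma randers_bound r : 0 <= r < rho -> `|b| ^+ 2 < f r ^+ 2 * g r.
Proof.
move=> rr; have fr := f0 rr; have g0 := randers_g_gt0 rr.
pose x := r *: e i1.
have rx : rcoord x = r by rewrite rcoord_e ger0_norm //; case/andP: rr.
have cx : cylinder rho x by rewrite /cylinder /= -[enorm _]/(rcoord _) rx; case/andP: rr.
have pos s : s ^+ 2 = 1 -> 0 < f r * Num.sqrt (g r) + b * s.
  move=> s1; have [F0 F00 _ _ _] := finslerF.2 x cx.
  have := randers_formula (s *: E0) cx; rewrite rx.
  have -> : bar (s *: E0) = 0 by apply/rowP => i; rewrite !mxE mulr0.
  have -> : enorm (0 : 'rV[R]_n) = 0.
    by rewrite /enorm big1 ?sqrtr0 // => i _; rewrite mxE expr0n.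
  rewrite !mxE !eqxx mulr1 s1 mulr1 expr0n addr0 => <-.
  rewrite lt_def F0 andbT; apply/eqP => /F00 /rowP/(_ ord0).
  by rewrite !mxE !eqxx mulr1 => s0; move: s1; rewrite s0 expr0n => /esym/eqP; rewrite oner_eq0.
have P1 := pos 1 (expr1n _ _); have P2 := pos (-1) ltac:(by rewrite sqrrN expr1n).
have S2 : Num.sqrt (g r) ^+ 2 = g r by rewrite sqr_sqrtr // ltW.
rewrite real_normK ?num_real // -S2 -exprMn -subr_gt0 subr_sqr mulr_gt0 //; lra.
Qed.

(** The coefficients of the Riemannian part are f^2 g and f^2 as functions of x. They are
    smooth across bar x = 0 because they are read off F itself:
    f = F (x, e2) and f sqrt g = F (x, e0) - b. *)
Lemma randers_is_randers : randers_metric (cylinder rho) F.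
Proof.
pose D x : 'rV[R]_n.+1 := \row_A (if A == ord0 then (F x E0 - b) ^+ 2 else F x (e i2) ^+ 2).
have E0n : E0 != 0 by apply/eqP => /rowP/(_ ord0) /eqP; rewrite !mxE !eqxx oner_eq0.
have en i : e i != 0 by exact/bar_neq0_neq0/bar_e_neq0.
have D0 x : cylinder rho x -> D x 0 ord0 = f (rcoord x) ^+ 2 * g (rcoord x).
  move=> cx; have rr := rc cx; have g0 := randers_g_gt0 rr.
  rewrite mxE eqxx randers_formula // !mxE !eqxx mulr1 addrK expr1n mulr1.
  have -> : enorm (bar E0) = 0.
    by rewrite enorm_bdot bdot_delta0 sqrtr0.
  by rewrite expr0n addr0 exprMn sqr_sqrtr // ltW.
have D1 x i : cylinder rho x -> D x 0 (lift ord0 i) = f (rcoord x) ^+ 2.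
  move=> cx; rewrite mxE /= F_psi ?bar_e_neq0 // enorm_e mul1r.
  by rewrite -[e i2]add0r -(scale0r E0) zcoord_e.
have Dpos x A : cylinder rho x -> 0 < D x 0 A.
  move=> cx; have rr := rc cx; case: (unliftP ord0 A) => [i ->|->].
    by rewrite D1 // exprn_gt0 // f0.
  by rewrite D0 // mulr_gt0 ?randers_g_gt0 // exprn_gt0 // f0.
have form x y : cylinder rho x -> (y *m diag_mx (D x) *m y^T) 0 0 =
    f (rcoord x) ^+ 2 * (g (rcoord x) * y 0 ord0 ^+ 2 + enorm (bar y) ^+ 2).
  move=> cx; rewrite mxE big_ord_recl mul_mx_diag !mxE eqxx -/(D x).
  rewrite (eq_bigr (fun i => f (rcoord x) ^+ 2 * (bar y 0 i * bar y 0 i))) => [|i _].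
    have := D0 x cx; rewrite mxE eqxx => ->.
    rewrite -mulr_sumr -[X in _ + _ * X]/(bdot y y) -sqr_enorm; ring.
  by rewrite [LHS]/= !mxE -barE; have := D1 x i cx; rewrite mxE => ->; ring.
have sF w : w != 0 -> smooth_on (cylinder rho) (fun x => F x w : R^o).
  move=> w0.
  pose A (x : V) : V * V := (x, 0).
  have linA : linear A.
    by move=> a v v'; apply/pair_equal_spec; split; rewrite //= scaler0 addr0.
  pose lA := GRing.isLinear.Build R V (V * V)%type *:%R A linA.
  pose A' : {linear V -> (V * V)%type} := HB.pack A lA.
  have cA : continuous A'.
    move=> x; have c1 : (v @[v --> x]) --> x by exact: cvg_id.
    have c2 := @cst_continuous V V 0 x.
    exact: (cvg_pair c1 c2).
  have := @smooth_on_affine R V (V * V)%type (slit rho) A' (0, w) (fun q => F q.1 q.2)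
    (@open_slit R n rho) cA finslerF.1.
  rewrite (_ : (fun q => _) = (fun x => F x w)); last first.
    by apply/funext => x; rewrite /= addr0 add0r.
  by apply: smooth_on_subset => x cx; split; rewrite /= ?addr0 ?add0r.
have oC := @open_cylinder R n rho.
exists (fun x => diag_mx (D x)), (fun=> b *: E0); split.
- split=> [A B|x cx].
    have sD : smooth_on (cylinder rho) (fun x => D x 0 A : R^o).
      apply: (smooth_on_eq oC (g := fun x => if A == ord0 then (F x E0 - b) ^+ 2 else F x (e i2) ^+ 2)).
        by move=> x _; rewrite mxE.
      case: eqP => _; apply: smooth_onX => //; last exact: sF.
      by apply: smooth_onB => //; [exact: sF|exact: smooth_on_cst].
    apply: (smooth_on_eq oC (g := fun x => D x 0 A * (A == B)%:R)).
      by move=> x _; rewrite mxE mulr_natr.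
    by apply: smooth_onM => //; exact: smooth_on_cst.
  split; first exact: tr_diag_mx.
  move=> v v0; rewrite mxE.
  have T A : (v *m diag_mx (D x)) 0 A * v^T A 0 = D x 0 A * v 0 A ^+ 2.
    by rewrite mul_mx_diag [v^T _ _]mxE [(\matrix_(i, j) _) _ _]mxE; ring.
  under eq_bigr do rewrite T.
  have T0 A : 0 <= D x 0 A * v 0 A ^+ 2 by rewrite mulr_ge0 ?sqr_ge0 // ltW // Dpos.
  rewrite lt_def sumr_ge0 // andbT psumr_eq0 //.
  apply: contra v0 => /allP H; apply/eqP/rowP => A; rewrite mxE.
  have := H A (mem_index_enum A).
  by rewrite /= mulf_eq0 gt_eqF ?Dpos //= sqrf_eq0 => /eqP.
- by move=> A; exact: smooth_on_cst.
- move=> x cx; set a := diag_mx _.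
  have d0 := Dpos x ord0 cx.
  have aU : a \in unitmx.
    rewrite unitmxE det_diag unitfE; apply/prodf_neq0 => A _.
    by rewrite gt_eqF // Dpos.
  have -> : (b *: E0) *m invmx a = (b / D x 0 ord0) *: E0.
    apply: (can_inj (mulmxK aU)); rewrite mulmxKV // -!scalemxAl.
    rewrite /a mul_mx_diag; apply/rowP => A; rewrite !mxE !eqxx /=.
    case: (A == ord0); last by rewrite mul0r !mulr0.
    by move: d0; rewrite mxE eqxx => d0; rewrite mulr1 mul1r divfK // gt_eqF.
  have EE k : ((k *: E0) *m (b *: E0)^T) 0 0 = k * b.
    rewrite mxE big_ord_recl big1 => [|i _]; rewrite !mxE ?eqxx /= ?mulr0 ?mul0r //.
    by rewrite !mulr1 addr0.
  rewrite EE D0 // -[1]sqrtr1 ltr_sqrt //.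
  have Bd := randers_bound (rc cx).
  have p0 : 0 < f (rcoord x) ^+ 2 * g (rcoord x) by apply: le_lt_trans Bd; exact: sqr_ge0.
  by rewrite mulrAC ltr_pdivrMr // mul1r -expr2 -real_normK ?num_real.
- move=> x y cx; rewrite form // randers_formula // sqrtrM ?sqr_ge0 // sqrtr_sqr gtr0_norm ?f0 ?rc //.
  congr (_ + _); rewrite -scalemxAl mxE; congr (_ * _).
  by rewrite mxE big_ord_recl big1 => [|i _]; rewrite !mxE ?eqxx ?mul0r // mul1r addr0.
Qed.

Lemma randers_alternative :
  randers_metric (cylinder rho) F /\
  exists (f g : R -> R) (b : R),
     [/\ differentiable_on (V := R^o) [set r | 0 <= r < rho] f,
         differentiable_on (V := R^o) [set r | 0 <= r < rho] g,
         forall r : R, 0 <= r < rho -> 0 < f r /\ 0 < g r,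
         forall r : R, 0 <= r < rho -> `|b| ^+ 2 < f r ^+ 2 * g r
       & forall x y : V, cylinder rho x -> bar x != 0 ->
           F x y = f (rcoord x) *
                     Num.sqrt (g (rcoord x) * y 0 ord0 ^+ 2 + enorm (bar y) ^+ 2)
                   + b * y 0 ord0].
Proof.
split; first exact: randers_is_randers.
exists f, g, b; split.
- by apply: derivable_differentiable_on => r; exact: derivable_waist.
- apply: derivable_differentiable_on => r rr.
  have w0 : waist psi r != 0 by rewrite gt_eqF // f0.
  have dn t := is_derive_normalized psi_smooth t (nrm rr) w0.
  have df := is_derive_waist psi_smooth (nrm rr).
  have davg := is_derive_mul (is_derive_add (dn 1) (dn (-1))) (is_derive_const (2^-1) _ _).
  have dsp := is_derive_sub (is_derive_mul davg davg) (is_derive_const 1 _ _).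
  have f20 : waist psi r * waist psi r != 0 by rewrite mulf_neq0.
  have [+ _] := is_derive_mul dsp (is_derive_inv (f := fun s => waist psi s * waist psi s) f20 (is_derive_mul df df)).
  by rewrite /g /spread; under eq_fun do rewrite -!expr2.
- by move=> r rr; rewrite f0 // randers_g_gt0.
- exact: randers_bound.
- by move=> x y cx _; exact: randers_formula.
Qed.

End RandersAlternative.

End Dichotomy.

(** * The alternative for metrics of vanishing Douglas curvature *)

Section DouglasImpliesAlternatives.
Variables (R : realType) (n : nat) (rho : R).
Variable F : 'rV[R]_n.+1 -> 'rV[R]_n.+1 -> R.
Variable psi : R^o * R^o -> R^o.
Variables i1 i2 : 'I_n.
Local Notation V := 'rV[R]_n.+1.
Hypothesis rho0 : 0 < rho.
Hypothesis i12 : i1 != i2.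
Hypothesis finslerF : finsler_metric (cylinder rho) F.
Hypothesis psi_smooth : smooth_on (strip rho) psi.
Hypothesis F_psi : forall x y, cylinder rho x -> bar y != 0 ->
  F x y = enorm (bar y) * psi (zcoord y, rcoord x).

Let J : set R := [set r | 0 < r < rho].
Let J_interval : is_interval J. Proof. exact: radii_interval. Qed.
Let nrm r : J r -> `|r| < rho.
Proof. by move=> /andP[r0 rr]; rewrite gtr0_norm. Qed.
Let f0 r : J r -> 0 < waist psi r.
Proof. by move=> /andP[/ltW r0 rr]; apply: (psi_gt0 i1 i2 finslerF F_psi); rewrite r0. Qed.

Lemma douglas_evolution : vanishing_douglas (cylinder rho) F ->
  forall r, J r -> quadratic_evolution psi r.
Proof.
move=> D0 r Jr; have rr : 0 <= r < rho by case/andP: Jr => /ltW -> ->.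
apply: (polynomial_spray_evolution psi_smooth Jr).
- by move=> z; exact: (intercept_gt0 i12 finslerF psi_smooth F_psi).
- by move=> z; exact: (dzz_gt0 i12 finslerF psi_smooth F_psi).
apply: (douglas0_spray_polynomial i12 finslerF psi_smooth F_psi Jr) => A i y y0.
apply: D0 => //; rewrite /cylinder /= -[enorm _]/(rcoord _) rcoord_e; exact: nrm.
Qed.

Let extend (f : R -> R) (c : R) : derivable (f : R^o -> R^o) 0 1 ->
  (forall r, J r -> f r = c) -> forall r, 0 <= r < rho -> f r = c.
Proof.
move=> fd fc r /andP[+ rr]; rewrite le_eqVlt => /orP[/eqP <-|r0]; last by apply: fc; rewrite /J /= r0.
apply: (continuous_right_eq (g := fun=> c) rho0).
- exact/differentiable_continuous/derivable1_diffP.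
- exact: cst_continuous.
- by move=> t; rewrite add0r => Jt; exact: fc.
Qed.

(** Defect and tilt are constant for 0 < r < rho; the value at r = 0 follows by continuity
    of the profile there. *)
Lemma randers_constants b : (forall r, J r -> quadratic_evolution psi r) ->
  (exists2 r, J r & tilt psi r = b /\ forall t, randers_defect psi t r = 0) ->
  (forall r, 0 <= r < rho -> tilt psi r = b) /\
  (forall t r, 0 <= r < rho -> randers_defect psi t r = 0).
Proof.
move=> ev [s Js [sb sd]].
have D t r (Jr : J r) := randers_defect_derive psi_smooth t (nrm Jr) (f0 Jr) (ev r Jr).
have r00 : 0 <= (0 : R) < rho by rewrite lexx.
have w0 : waist psi 0 != 0 by rewrite gt_eqF // (psi_gt0 i1 i2 finslerF F_psi).
have n0 : `|0 : R| < rho by rewrite normr0.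
have dn t := is_derive_normalized psi_smooth t n0 w0.
have dt := is_derive_mul (is_derive_sub (dn 1) (dn (-1))) (is_derive_const (2^-1) _ _).
have da := is_derive_mul (is_derive_add (dn 1) (dn (-1))) (is_derive_const (2^-1) _ _).
split=> [|t].
  apply: extend; first by have [] := dt.
  move=> r Jr; rewrite -sb; apply: (derive0_constant J_interval) => // u Ju.
  exact: (D 0 u Ju).2.
apply: extend.
  have dc := is_derive_sub (dn t) (is_derive_cmul t dt).
  have [+ _] := is_derive_sub
    (is_derive_sub (is_derive_mul dc dc) (is_derive_const 1 _ _))
    (is_derive_mul (is_derive_sub (is_derive_mul da da) (is_derive_const 1 _ _))
      (is_derive_const (t ^+ 2) _ _)).
  by rewrite /randers_defect /spread; under eq_fun do rewrite -!expr2.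
move=> r Jr; rewrite -(sd t); apply: (derive0_constant J_interval) => // u Ju.
exact: (D t u Ju).1.
Qed.

(** If the quadratic part of the speed is nonzero at a single radius, the defect vanishes
    there, hence at every radius. *)
Lemma evolution_alternative : (forall r, J r -> quadratic_evolution psi r) ->
  (forall r, J r -> forall t, is_derive r (1 : R) (normalized psi t) 0) \/
  exists b, (forall r, 0 <= r < rho -> tilt psi r = b) /\
    (forall t r, 0 <= r < rho -> randers_defect psi t r = 0).
Proof.
move=> ev; have [|H] := pselect (forall r, J r ->
  forall t, is_derive r (1 : R) (normalized psi t) 0); [by left|right].
have [s Js Hs] : exists2 s, J s & ~ forall t, is_derive s (1 : R) (normalized psi t) 0.
  apply: contrapT => N; apply: H => r Jr; apply: contrapT => Nr; apply: N; by exists r.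
exists (tilt psi s); apply: randers_constants => //; exists s => //; split=> // t.
have [A [B [E HB]]] := ev s Js.
have B0 : B != 0.
  apply/eqP => B0; apply: Hs => u.
  apply: is_derive_eq (is_derive_normalized_quadratic psi_smooth u (nrm Js) _ E) _.
    by rewrite gt_eqF // f0.
  by rewrite B0 !mul0r.
have [g g0 [b {}HB]] := HB B0.
by apply: (randers_defect0 g0 (f0 Js)) => z; exact: (HB z).1.
Qed.

End DouglasImpliesAlternatives.

(** * A polynomial spray has vanishing Douglas curvature *)

Section QuadraticMaps.
Variables (R : realType) (V : normedModType R).

Lemma is_derive_linear_form (l : V -> R) y v :
  (forall a v w, l (a *: v + w) = a * l v + l w) ->
  is_derive y v (l : V -> R^o) (l v).
Proof.
move=> ll; apply/is_derive_lineP; under eq_fun do rewrite ll.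
by apply: is_derive_eq; rewrite /GRing.scale /=; ring.
Qed.

Lemma is_derive_quadratic_form (B : V -> V -> R) y v :
  (forall a v w x, B (a *: v + w) x = a * B v x + B w x) ->
  (forall a v w x, B x (a *: v + w) = a * B x v + B x w) ->
  is_derive y v (fun y => B y y : R^o) (B v y + B y v).
Proof.
move=> Bl Br; apply/is_derive_lineP.
rewrite (_ : (fun h : R => _) =
  (fun h : R => (h * B v v + B y v + B v y) * h + B y y)); last first.
  by apply/funext => h; rewrite Bl !Br; ring.
by apply: is_derive_eq; rewrite /GRing.scale /=; ring.
Qed.

Lemma third_derive_quadratic_form (B : V -> V -> R) y v w x :
  (forall a v w x, B (a *: v + w) x = a * B v x + B w x) ->
  (forall a v w x, B x (a *: v + w) = a * B x v + B x w) ->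
  'D_x (fun y => 'D_w (fun y => 'D_v (fun y => B y y : R^o) y : R^o) y : R^o) y = 0.
Proof.
move=> Bl Br.
have E1 : (fun y => 'D_v (fun y => B y y : R^o) y : R^o) = fun y => B v y + B y v.
  by apply/funext => z; exact: (derive_val (is_derive := is_derive_quadratic_form z v Bl Br)).
have E2 : (fun y => 'D_w (fun y => B v y + B y v : R^o) y : R^o) = cst (B v w + B w v).
  apply/funext => z; have L : forall a u u', B v (a *: u + u') + B (a *: u + u') v =
      a * (B v u + B u v) + (B v u' + B u' v) by move=> a u u'; rewrite Br Bl; ring.
  exact: (derive_val (is_derive := is_derive_linear_form z w L)).
by rewrite E1 E2 derive_cst.
Qed.

End QuadraticMaps.

Section PolynomialSprayImpliesDouglas.
Variables (R : realType) (n : nat) (rho : R).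
Variable F : 'rV[R]_n.+1 -> 'rV[R]_n.+1 -> R.
Variable psi : R^o * R^o -> R^o.
Variables i1 i2 : 'I_n.
Local Notation V := 'rV[R]_n.+1.
Local Notation E0 := (delta_mx 0 ord0 : V).
Local Notation e := (fun i => delta_mx 0 (lift ord0 i) : V).
Hypothesis i12 : i1 != i2.
Hypothesis finslerF : finsler_metric (cylinder rho) F.
Hypothesis psi_smooth : smooth_on (strip rho) psi.
Hypothesis F_psi : forall x y, cylinder rho x -> bar y != 0 ->
  F x y = enorm (bar y) * psi (zcoord y, rcoord x).
Implicit Types (x y v w : V).

Let nrm r : 0 < r < rho -> `|r| < rho.
Proof. by move=> /andP[r0 rr]; rewrite gtr0_norm. Qed.

Lemma derivable_spray_parallel z r : 0 < r < rho ->
  exists c, is_derive z (1 : R) (fun z : R => spray_parallel psi (z, r) : R) c.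
Proof.
move=> Jr; have rr := nrm Jr; have [r0 _] := andP Jr.
have cr : 0 <= r < rho by case/andP: Jr => /ltW -> ->.
have f0 := psi_gt0 i1 i2 finslerF F_psi z cr.
have m0 := intercept_gt0 i12 finslerF psi_smooth F_psi z cr.
have zz0 := dzz_gt0 i12 finslerF psi_smooth F_psi z cr.
have sz := smooth_dz psi_smooth; have szz := smooth_dz sz.
have sr := smooth_dr psi_smooth; have srz := smooth_dr sz.
have di := is_derive_id z (1 : R).
have df := is_derive_dz z psi_smooth rr; have dm := is_derive_intercept_z z psi_smooth rr.
have dfz := is_derive_dz z sz rr; have dfzz := is_derive_dz z szz rr.
have dfr := is_derive_dz z sr rr; have dfrz := is_derive_dz z srz rr.
have dX := is_derive_mul df dm.
have dXz := is_derive_sub (is_derive_mul dfz dm) (is_derive_mul (is_derive_mul df di) dfzz).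
have dXr := is_derive_add (is_derive_mul dfr dm)
  (is_derive_mul df (is_derive_sub dfr (is_derive_mul di dfrz))).
have zzN : dz (dz psi) (z, r) != 0 by rewrite gt_eqF.
have dnum := is_derive_sub dXr (is_derive_mul (is_derive_mul dXz dfrz)
  (is_derive_inv (f := fun z : R => dz (dz psi) (z, r)) zzN dfzz)).
have XN : 2 * r * (psi (z, r) * intercept psi (z, r)) != 0.
  by rewrite !mulf_neq0 // gt_eqF.
eexists; exact: (is_derive_mul dnum (is_derive_inv
  (f := fun z : R => 2 * r * (psi (z, r) * intercept psi (z, r))) XN (is_derive_cmul (2 * r) dX))).
Qed.

Section AtBasePoint.
Variables (x : V) (a b d : R).
Hypothesis cx : cylinder rho x.
Hypothesis x0 : bar x != 0.
Hypothesis poly : forall z,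
  spray_radial psi (z, rcoord x) = a * z ^+ 2 + b /\ spray_axial psi (z, rcoord x) = d * z.

Let rx : 0 < rcoord x < rho.
Proof. by rewrite cx andbT; exact: enorm_gt0. Qed.

Let M y := bdot x y * spray_parallel psi (zcoord y, rcoord x).
Let Z (C : 'I_n.+1) y w : R := (a * (y 0 ord0 * w 0 ord0) + b * bdot y w) *
    ((- x 0 ord0) *: E0 + x) 0 C + d * (bdot x y * w 0 ord0) * E0 0 C.

Let spray_quadratic C y : bar y != 0 -> spray F C x y = M y * y 0 C + Z C y y.
Proof.
move=> y0; rewrite (spray_sphericalE i12 finslerF psi_smooth F_psi) //.
have u0 := enorm_gt0 y0.
have add (v w : V) A : (v + w) 0 A = v 0 A + w 0 A by rewrite mxE.
have scale (k : R) (v : V) A : (k *: v) 0 A = k * v 0 A by rewrite mxE.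
rewrite /spray_vector (poly _).1 (poly _).2 /Z /M -!sqr_enorm.
have -> : y 0 ord0 = zcoord y * enorm (bar y) by rewrite /zcoord divfK // gt_eqF.
by rewrite !add !scale !add !scale; ring.
Qed.

Let Z_linl C k v w y : Z C (k *: v + w) y = k * Z C v y + Z C w y.
Proof. by rewrite /Z bdot_linl bdot_linr ![(_ *: v + w) _ _]mxE ![(_ *: v) _ _]mxE; ring. Qed.

Let Z_linr C k v w y : Z C y (k *: v + w) = k * Z C y v + Z C y w.
Proof. by rewrite /Z !bdot_linr ![(_ *: v + w) _ _]mxE ![(_ *: v) _ _]mxE; ring. Qed.

Let is_derive_M y v : bar y != 0 -> exists c,
  forall v, is_derive y v (M : V -> R^o) (bdot x v * spray_parallel psi (zcoord y, rcoord x) +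
    bdot x y * (c * ((v 0 ord0 - zcoord y * radial y v) / enorm (bar y)))).
Proof.
move=> y0; have [c dP] := derivable_spray_parallel (zcoord y) rx; exists c => w.
have L k u u' : bdot x (k *: u + u') = k * bdot x u + bdot x u' by exact: bdot_linr.
apply: is_derive_eq (is_derive_mul (is_derive_linear_form y w L)
  (is_derive_chain (is_derive_zcoord w y0) dP)) _.
by ring.
Qed.

Let divergence y : bar y != 0 ->
  \sum_(E < n.+1) dy E (spray F E) x y = n.+2%:R * M y + (2 * b + d) * bdot x y.
Proof.
move=> y0; have u0 := enorm_gt0 y0.
have [c dM] := is_derive_M 0 y0.
pose DM v := bdot x v * spray_parallel psi (zcoord y, rcoord x) +
    bdot x y * (c * ((v 0 ord0 - zcoord y * radial y v) / enorm (bar y))).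
have D E : dy E (spray F E) x y = M y + DM (delta_mx 0 E) * y 0 E +
    (Z E (delta_mx 0 E) y + Z E y (delta_mx 0 E)).
  have dE := is_derive_add (is_derive_mul (dM (delta_mx 0 E)) (is_derive_coord E y (delta_mx 0 E)))
     (is_derive_quadratic_form y (delta_mx 0 E) (@Z_linl E) (@Z_linr E)).
  rewrite /dy /partial; apply: (derive_near_eq (@open_bar_neq0 R n) y0 _ (is_derive_eq dE _)).
    by move=> w w0; rewrite spray_quadratic.
  have -> : (delta_mx 0 E : V) 0 E = 1 by rewrite mxE !eqxx.
  by rewrite /DM; ring.
rewrite (eq_bigr _ (fun E _ => D E)) big_split [X in X + _ = _]big_split /=.
rewrite sumr_const card_ord.
have LM k v w : DM (k *: v + w) = k * DM v + DM w.
  by rewrite /DM bdot_linr radial_lin ![(_ *: v + w) _ _]mxE ![(_ *: v) _ _]mxE; ring.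
rewrite (linear_coord_sum LM).
have -> : DM y = M y.
  rewrite /DM radial_self // /M.
  have -> : y 0 ord0 = zcoord y * enorm (bar y) by rewrite /zcoord divfK // gt_eqF.
  by rewrite subrr mul0r !mulr0 addr0.
have split_sum : \sum_(E < n.+1) (Z E (delta_mx 0 E) y + Z E y (delta_mx 0 E))
    = (2 * b + d) * bdot x y.
  rewrite big_ord_recl /=.
  have -> : \sum_(i < n) (Z (lift ord0 i) (e i) y + Z (lift ord0 i) y (e i)) = 2 * b * bdot x y.
    rewrite /bdot mulr_sumr; apply: eq_bigr => i _.
    rewrite /Z (bdotC (e i) y) !bdot_delta !barE !mxE !eqxx /=; ring.
  by rewrite /Z (bdotC E0 y) !bdot_delta0 !mxE !eqxx /=; ring.
by rewrite split_sum -mulr_natl (_ : n.+2%:R = n.+1%:R + 1 :> R) ?natr1 //; ring.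
Qed.

Let k := (2 * b + d) / n.+2%:R.
Let T C y w : R := Z C y w - k * (bdot x y * w 0 C).

Let projective_spray_quadratic C y : bar y != 0 -> projective_spray F C x y = T C y y.
Proof.
move=> y0; rewrite /projective_spray spray_quadratic // divergence // /T /k.
have : n.+2%:R != 0 :> R by rewrite pnatr_eq0.
by move: (n.+2%:R) => N N0; field.
Qed.

(** The spray is M y + Z with Z quadratic in y and M homogeneous of degree 1. By Euler's
    identity its divergence is (n + 2) M plus a linear form, so subtracting the trace
    part removes M and leaves a quadratic map, whose third derivatives vanish. *)
Lemma polynomial_spray_douglas A B C D y : bar y != 0 ->
  douglas_curvature F A B C D x y = 0.
Proof.
move=> y0.
have oU := @open_bar_neq0 R n.
have Tl k' v w z : T A (k' *: v + w) z = k' * T A v z + T A w z.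
  by rewrite /T Z_linl bdot_linr; ring.
have Tr k' v w z : T A z (k' *: v + w) = k' * T A z v + T A z w.
  by rewrite /T Z_linr ![(_ *: v + w) _ _]mxE ![(_ *: v) _ _]mxE; ring.
rewrite douglas_curvatureE (iter_derive_eq oU _ (projective_spray_quadratic A) y0).
exact: (third_derive_quadratic_form _ _ _ _ Tl Tr).
Qed.

End AtBasePoint.

(** The Douglas curvature is continuous on the slit tangent bundle, and every point of it
    is approached along (x + t e1, y + t e1) by points where neither barred part
    vanishes. *)
Lemma generic_douglas :
  (forall A B C D x y, cylinder rho x -> bar x != 0 -> bar y != 0 ->
     douglas_curvature F A B C D x y = 0) ->
  vanishing_douglas (cylinder rho) F.
Proof.
move=> H A B C D x y cx y0.
have oS := @open_slit R n rho.
have sD : smooth_on (slit rho) (fun p : V * V => douglas_curvature F A B C D p.1 p.2 : R^o).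
  exact: (smooth_on_douglas oS finslerF.1 (finsler_posdef finslerF)).
pose l (t : R) : V * V := (x + t *: e i1, y + t *: e i1).
have l0 : l 0 = (x, y) by rewrite /l scale0r !addr0.
have cl : {for 0, continuous l}.
  have c (v : V) : (v + s *: e i1) @[s --> (0 : R)] --> v + (0 : R) *: e i1.
    by apply: cvgD; [exact: cvg_cst|apply: cvgZr_tmp; exact: cvg_id].
  exact: (cvg_pair (c x) (c y)).
have nbarS v : \forall t \near 0^'+, bar (v + t *: e i1) != 0.
  have E t : bar (v + t *: e i1) 0 i1 = v 0 (lift ord0 i1) + t.
    by rewrite !mxE !eqxx mulr1.
  have N : \forall t \near 0^'+, v 0 (lift ord0 i1) + t != 0.
    have [->|v0] := eqVneq (v 0 (lift ord0 i1)) 0.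
      by near=> t; rewrite add0r gt_eqF //; near: t; exact: nbhs_right_gt.
    near=> t; apply/eqP => /eqP; rewrite addr_eq0 => /eqP E0'.
    have tv : t < `|v 0 (lift ord0 i1)|.
      by near: t; apply: nbhs_right_lt; rewrite normr_gt0.
    have t0 : 0 < t by near: t; exact: nbhs_right_gt.
    by move: tv; rewrite E0' normrN gtr0_norm // ltxx.
  by apply: filterS N => t; apply: contraNneq => bt; rewrite -E bt mxE.
have := @continuous_right_near_eq R (fun t => douglas_curvature F A B C D (l t).1 (l t).2)
  (fun=> 0) 0; rewrite l0; apply.
- apply: (@continuous_comp _ _ _ l (fun p : V * V => douglas_curvature F A B C D p.1 p.2)) => //.
  by rewrite l0; apply/differentiable_continuous/(smooth_on_differentiable sD).
- exact: cst_continuous.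
have NS : \forall t \near 0^'+, slit rho (l t).
  have cr : l t @[t --> 0^'+] --> l 0 by exact: cvg_at_right_filter.
  by apply: (cr (slit rho)); rewrite l0; exact: open_nbhs_nbhs.
near=> t; apply: H.
- by have [] : slit rho (l t) by near: t.
- by near: t; exact: nbarS.
- by near: t; exact: nbarS.
Unshelve. all: by end_near. Qed.

End PolynomialSprayImpliesDouglas.

(** * The profiles of the two families, and the theorem *)

Lemma differentiable_on_derivable (R : realType) (rho : R) (f : R -> R) r :
  differentiable_on (V := R^o) [set r | 0 <= r < rho] f -> 0 < r < rho ->
  is_derive r (1 : R) f ('D_1 (f : R^o -> R^o) r).
Proof.
move=> fd rr; have [r0 rrho] := andP rr.
have [|L [Lc H]] := fd r; first by rewrite /= ltW.
apply/derivableP/derivable1_diffP/differentiable_linear_approx.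
exists L; split=> // e e0.
have : \forall q \near r, 0 < q < rho.
  have : \forall q \near r, 0 < q by exact: lt_nbhsr.
  have : \forall q \near r, q < rho by exact: lt_nbhsl.
  by apply: filterS2 => q -> ->.
by have := H e e0; rewrite near_withinE; apply: filterS2 => q + /andP[/ltW q0 qr]; apply => /=; rewrite q0.
Qed.

Section ProfilesOfTheTwoFamilies.
Variables (R : realType) (rho : R).
Variable psi : R^o * R^o -> R^o.
Hypothesis psi_smooth : smooth_on (strip rho) psi.
Variable r : R.
Hypothesis r_range : 0 < r < rho.

Let r0 : 0 < r. Proof. by case/andP: r_range. Qed.
Let rr : `|r| < rho. Proof. by case/andP: r_range => _; rewrite gtr0_norm. Qed.
Let nrm s : 0 < s < rho -> `|s| < rho.
Proof. by move=> /andP[s0 sr]; rewrite gtr0_norm. Qed.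
Let openJ : open [set s : R | 0 < s < rho].
Proof.
rewrite (_ : [set s | _] = [set s : R | 0 < s] `&` [set s | s < rho]).
  by apply: openI; [exact: open_gt|exact: open_lt].
by apply/seteqP; split=> s /= => [/andP[]|[-> ->]].
Qed.

Lemma dz_eq (g : R^o * R^o -> R^o) (k : R -> R) z s c : smooth_on (strip rho) g ->
  0 < s < rho -> (forall z, g (z, s) = k z) -> is_derive z (1 : R) k c -> dz g (z, s) = c.
Proof.
move=> sg sr gk [_ <-]; rewrite -(derive_val (is_derive := is_derive_dz z sg (nrm sr))).
by congr ('D_1 _ z); apply/funext => t; rewrite gk.
Qed.

Lemma dr_eq (g : R^o * R^o -> R^o) (k : R -> R) z c : smooth_on (strip rho) g ->
  (forall s, 0 < s < rho -> g (z, s) = k s) -> is_derive r (1 : R) k c -> dr g (z, r) = c.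
Proof.
move=> sg gk kd; rewrite -(derive_val (is_derive := is_derive_dr z sg rr)).
by apply: (derive_near_eq openJ _ _ kd).
Qed.

(** Here psi_r = - (h' / h) m with m the intercept, so q depends on r only. *)
Lemma scaling_profile_polynomial (h G : R -> R) :
  (forall s, 0 < s < rho -> 0 < h s) ->
  is_derive r (1 : R) h ('D_1 (h : R^o -> R^o) r) ->
  (forall t, derivable (G : R^o -> R^o) t 1 /\ derivable (derive1 (G : R^o -> R^o)) t 1) ->
  (forall z, 0 < intercept psi (z, r)) -> (forall z, 0 < dz (dz psi) (z, r)) ->
  (forall z s, 0 < s < rho -> psi (z, s) = (h s)^-1 * G (h s * z)) ->
  exists a b d, forall z, spray_radial psi (z, r) = a * z ^+ 2 + b /\
    spray_axial psi (z, r) = d * z.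
Proof.
move=> h0 hd Gd m0 zz0 E; set h' := 'D_1 _ r in hd.
have sz := smooth_dz psi_smooth.
have hr := h0 r r_range; have hN : h r != 0 by rewrite gt_eqF.
pose G1 := derive1 (G : R^o -> R^o); pose G2 := derive1 G1.
have dG t : is_derive t (1 : R) G (G1 t).
  by rewrite /G1 derive1E; exact/derivableP/(Gd t).1.
have dG1 t : is_derive t (1 : R) G1 (G2 t).
  by rewrite /G2 derive1E; exact/derivableP/(Gd t).2.
have lin c z : is_derive z (1 : R) (fun z : R => c * z : R) c.
  by apply: is_derive_eq; rewrite /GRing.scale /=; ring.
have Ez z s : 0 < s < rho -> dz psi (z, s) = G1 (h s * z).
  move=> sr; apply: (dz_eq psi_smooth sr (fun z => E z s sr)).
  apply: is_derive_eq (is_derive_cmul _ (is_derive_chain (lin (h s) z) (dG _))) _.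
  by field; rewrite gt_eqF // h0.
have Ezz z : dz (dz psi) (z, r) = h r * G2 (h r * z).
  apply: (dz_eq sz r_range (fun z => Ez z r r_range)).
  by apply: is_derive_eq (is_derive_chain (lin (h r) z) (dG1 _)) _; rewrite mulrC.
have hz z : is_derive r (1 : R) (fun s : R => h s * z : R) (h' * z).
  by apply: is_derive_eq (is_derive_mul hd (is_derive_const z _ _)) _; ring.
have Er z : dr psi (z, r) = - (h' / h r) * intercept psi (z, r).
  apply: (dr_eq psi_smooth (fun s => E z s)).
  apply: is_derive_eq (is_derive_mul (is_derive_inv hN hd) (is_derive_chain (hz z) (dG _))) _.
  by rewrite /intercept /= E // Ez //; field.
have Erz z : dr (dz psi) (z, r) = G2 (h r * z) * (h' * z).
  exact: (dr_eq sz (fun s => Ez z s) (is_derive_chain (hz z) (dG1 _))).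
exists 0, (h' / (2 * r * h r)), (h' / (r * h r)) => z.
have mz := m0 z; have zzz := zz0 z.
have R1 : spray_radial psi (z, r) = h' / (2 * r * h r).
  by rewrite /spray_radial Er /=; field; rewrite hN !gt_eqF.
split; first by rewrite R1 mul0r add0r.
rewrite /spray_axial R1 Erz Ezz /=.
have G20 : G2 (h r * z) != 0.
  by move: zzz; rewrite Ezz pmulr_rgt0 // => /gt_eqF ->.
by field; rewrite hN G20 gt_eqF.
Qed.

(** Both psi_r / m and psi_zr / psi_zz are polynomials in z once the square of
    S = sqrt (1 + g z^2) is expanded, and the cubic terms of eps cancel. *)
Lemma randers_profile_polynomial (f g : R -> R) (b : R) :
  (forall s, 0 < s < rho -> 0 < f s /\ 0 < g s) ->
  is_derive r (1 : R) f ('D_1 (f : R^o -> R^o) r) ->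
  is_derive r (1 : R) g ('D_1 (g : R^o -> R^o) r) ->
  (forall z s, 0 < s < rho -> psi (z, s) = f s * Num.sqrt (1 + g s * z ^+ 2) + b * z) ->
  exists a b d, forall z, spray_radial psi (z, r) = a * z ^+ 2 + b /\
    spray_axial psi (z, r) = d * z.
Proof.
move=> fg0 fd gd E; set f' := 'D_1 _ r in fd; set g' := 'D_1 _ r in gd.
have sz := smooth_dz psi_smooth.
pose S s z := Num.sqrt (1 + g s * z ^+ 2).
have s0 s z : 0 < s < rho -> 0 < 1 + g s * z ^+ 2.
  by move=> /fg0[_ gs]; rewrite ltr_pwDl // mulr_ge0 ?sqr_ge0 // ltW.
have S0 s z : 0 < s < rho -> 0 < S s z by move=> sr; rewrite sqrtr_gt0 s0.
have SS s z : 0 < s < rho -> S s z ^+ 2 = 1 + g s * z ^+ 2.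
  by move=> sr; rewrite sqr_sqrtr // ltW // s0.
have [fr gr] := fg0 r r_range.
have Sz z s : 0 < s < rho -> is_derive z (1 : R) (S s) (g s * z / S s z).
  by move=> /fg0[_ gs]; exact: is_derive_sqrt_quadratic.
have Sr z : is_derive r (1 : R) (fun s => S s z : R) (g' * z ^+ 2 / (2 * S r z)).
  have D : is_derive r (1 : R) (fun s : R => 1 + g s * z ^+ 2 : R) (g' * z ^+ 2).
    apply: is_derive_eq (is_derive_add (is_derive_const 1 _ _)
      (is_derive_mul gd (is_derive_const (z ^+ 2) _ _))) _.
    by ring.
  apply: is_derive_eq (is_derive_chain D (is_derive1_sqrt (s0 r z r_range))) _.
  by rewrite mulrC.
have lin c z : is_derive z (1 : R) (fun z : R => c * z : R) c.
  by apply: is_derive_eq; rewrite /GRing.scale /=; ring.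
have Ez z s : 0 < s < rho -> dz psi (z, s) = f s * g s * z / S s z + b.
  move=> sr; apply: (dz_eq psi_smooth sr (fun z => E z s sr)).
  apply: is_derive_eq (is_derive_add (is_derive_cmul (f s) (Sz z s sr)) (lin b z)) _.
  by field; rewrite gt_eqF // S0.
have Sr0 z : S r z != 0 by rewrite gt_eqF // S0.
have SSr z : S r z ^+ 2 = 1 + g r * z ^+ 2 by exact: SS.
have Ezz z : dz (dz psi) (z, r) = f r * g r / S r z ^+ 3.
  apply: (dz_eq sz r_range (fun z => Ez z r r_range)).
  apply: is_derive_eq (is_derive_add (is_derive_mul (lin (f r * g r) z)
    (is_derive_inv (Sr0 z) (Sz z r r_range))) (is_derive_const b _ _)) _.
  have -> : f r * g r / S r z ^+ 3 = f r * g r * (S r z ^+ 2 - g r * z ^+ 2) / S r z ^+ 3.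
    by rewrite SSr addrK mulr1.
  by field.
have Er z : dr psi (z, r) = f' * S r z + f r * (g' * z ^+ 2 / (2 * S r z)).
  apply: (dr_eq psi_smooth (fun s => E z s)).
  apply: is_derive_eq (is_derive_add (is_derive_mul fd (Sr z)) (is_derive_const (b * z) _ _)) _.
  by rewrite -/(S r z); ring.
have Erz z : dr (dz psi) (z, r) =
    (f' * g r + f r * g') * z / S r z - f r * g r * g' * z ^+ 3 / (2 * S r z ^+ 3).
  apply: (dr_eq sz (fun s => Ez z s)).
  apply: is_derive_eq (is_derive_add (is_derive_mul
    (is_derive_mul (is_derive_mul fd gd) (is_derive_const z _ _))
    (is_derive_inv (f := fun s => S s z) (Sr0 z) (Sr z))) (is_derive_const b _ _)) _.
  by field.
have Em z : intercept psi (z, r) = f r / S r z.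
  rewrite /intercept /= E // Ez // -/(S r z).
  have -> : f r / S r z = f r * (S r z ^+ 2 - g r * z ^+ 2) / S r z by rewrite SSr addrK mulr1.
  by field.
have fN : f r != 0 by rewrite gt_eqF.
have gN : g r != 0 by rewrite gt_eqF.
have rN : r != 0 by rewrite gt_eqF.
exists (- (f' / f r * g r + g' / 2) / (2 * r)), (- (f' / f r) / (2 * r)), (g' / (2 * r * g r)) => z.
have R1 : spray_radial psi (z, r) =
    - (f' / f r * S r z ^+ 2 + g' / 2 * z ^+ 2) / (2 * r).
  by rewrite /spray_radial Er Em /=; field; rewrite Sr0 fN rN.
split; first by rewrite R1 SSr; field; rewrite fN rN.
rewrite /spray_axial R1 Erz Ezz /=.
have -> : z * (- (f' / f r * S r z ^+ 2 + g' / 2 * z ^+ 2) / (2 * r)) +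
   ((f' * g r + f r * g') * z / S r z - f r * g r * g' * z ^+ 3 / (2 * S r z ^+ 3)) /
   (2 * r * (f r * g r / S r z ^+ 3)) = g' * z * (S r z ^+ 2 - g r * z ^+ 2) / (2 * r * g r).
  by field; rewrite Sr0 fN gN rN.
by rewrite SSr addrK; field; rewrite gN rN.
Qed.

End ProfilesOfTheTwoFamilies.

Theorem theorem2 (R : realType) (n : nat) (hn : (2 <= n)%N)
    (rho : R) (hrho : 0 < rho)
    (phi : R -> R -> R)
    (hphi : differentiable_on (V := (R^o * R^o)%type)
              [set p | 0 <= p.2 < rho] (fun p => phi p.1 p.2))
    (F : 'rV[R]_n.+1 -> 'rV[R]_n.+1 -> R)
    (hF : finsler_metric (cylinder rho) F)
    (hFphi : forall x y : 'rV[R]_n.+1,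
       cylinder rho x -> bar x != 0 -> bar y != 0 ->
       F x y = enorm (bar y) * Num.sqrt (phi (zcoord y) (rcoord x))) :
  vanishing_douglas (cylinder rho) F <->
  (randers_metric (cylinder rho) F /\
   exists (f g : R -> R) (b : R),
     [/\ differentiable_on (V := R^o) [set r | 0 <= r < rho] f,
         differentiable_on (V := R^o) [set r | 0 <= r < rho] g,
         forall r : R, 0 <= r < rho -> 0 < f r /\ 0 < g r,
         forall r : R, 0 <= r < rho -> `|b| ^+ 2 < f r ^+ 2 * g r
       & forall x y : 'rV[R]_n.+1, cylinder rho x -> bar x != 0 ->
           F x y = f (rcoord x) *
                     Num.sqrt (g (rcoord x) * y 0 ord0 ^+ 2 + enorm (bar y) ^+ 2)
                   + b * y 0 ord0])
  \/
  (exists (h G : R -> R),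
     [/\ differentiable_on (V := R^o) [set r | 0 <= r < rho] h,
         forall r : R, 0 <= r < rho -> 0 < h r,
         forall t : R,
           [/\ derivable (G : R^o -> R^o) t 1,
               derivable (derive1 (G : R^o -> R^o)) t 1 & 0 < G t],
         forall t : R,
           0 < G t - t * derive1 (G : R^o -> R^o) t /\
           0 < derive1 (derive1 (G : R^o -> R^o)) t
       & forall x y : 'rV[R]_n.+1,
           cylinder rho x -> bar x != 0 -> bar y != 0 ->
           F x y = enorm (bar y) * (h (rcoord x))^-1
                     * G (h (rcoord x) * zcoord y)]).
Proof.
pose i1 : 'I_n := Ordinal (leq_trans (isT : (1 <= 2)%N) hn).
pose i2 : 'I_n := Ordinal hn.
have i12 : i1 != i2 by [].
pose psi := profile F i1 i2.
have psi_smooth : smooth_on (strip rho) psi by exact: smooth_profile.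
have F_psi : forall x y, cylinder rho x -> bar y != 0 ->
    F x y = enorm (bar y) * psi (zcoord y, rcoord x).
  by move=> x y cx y0; exact: (profile_formula i1 i2 hF hrho hFphi cx y0).
have m0 z r : 0 < r < rho -> 0 < intercept psi (z, r).
  by move=> /andP[/ltW r0 rr]; apply: (intercept_gt0 i12 hF psi_smooth F_psi); rewrite r0.
have zz0 z r : 0 < r < rho -> 0 < dz (dz psi) (z, r).
  by move=> /andP[/ltW r0 rr]; apply: (dzz_gt0 i12 hF psi_smooth F_psi); rewrite r0.
have xP r : 0 < r < rho -> let x := r *: delta_mx 0 (lift ord0 i1) : 'rV[R]_n.+1 in
    [/\ cylinder rho x, bar x != 0 & rcoord x = r].
  move=> /andP[r0 rr] x; have rx : rcoord x = r by rewrite rcoord_e gtr0_norm.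
  split=> //; first by rewrite /cylinder /= -[enorm _]/(rcoord x) rx.
  by rewrite -bdot_eq0 -sqr_enorm -[enorm _]/(rcoord x) rx sqrf_eq0 gt_eqF.
have yP z : let y := z *: delta_mx 0 ord0 + delta_mx 0 (lift ord0 i2) : 'rV[R]_n.+1 in
    [/\ bar y != 0, enorm (bar y) = 1, zcoord y = z & y 0 ord0 = z].
  split; rewrite ?bar_zE0 ?bar_e_neq0 ?enorm_e ?zcoord_e //.
  by rewrite !mxE !eqxx /= mulr1 addr0.
have reduce : (forall r, 0 < r < rho -> exists a b d, forall z,
    spray_radial psi (z, r) = a * z ^+ 2 + b /\ spray_axial psi (z, r) = d * z) ->
    vanishing_douglas (cylinder rho) F.
  move=> H; apply: (@generic_douglas R n rho F i1 hF) => A B C D x y cx x0 y0.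
  have [|a [b [d P]]] := H (rcoord x); first by rewrite cx andbT; exact: enorm_gt0.
  exact: (polynomial_spray_douglas i12 hF psi_smooth F_psi cx x0 P).
have co r : 0 < r < rho -> 0 <= r < rho by move=> /andP[/ltW -> ->].
split.
  move=> /(douglas_evolution i12 hF psi_smooth F_psi) ev.
  have [dN|[b [tb d0]]] := evolution_alternative i1 i2 hrho hF psi_smooth F_psi ev.
    by right; exact: (scaling_alternative hrho i12 hF psi_smooth F_psi dN).
  by left; exact: (randers_alternative i12 hF psi_smooth F_psi tb d0).
case=> [[_ [f [g [b [fd gd fg0 _ E]]]]]|[h [G [hd h0 Gd _ E]]]]; apply: reduce => r Jr.
  apply: (randers_profile_polynomial psi_smooth Jr (f := f) (g := g) (b := b)).
  - by move=> s /co; exact: fg0.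
  - exact: differentiable_on_derivable fd Jr.
  - exact: differentiable_on_derivable gd Jr.
  - move=> z s Js; have [cx x0 rx] := xP s Js; have [y0 uy zy y0z] := yP z.
    have := E _ (z *: delta_mx 0 ord0 + delta_mx 0 (lift ord0 i2)) cx x0.
    by rewrite F_psi // rx uy zy y0z mul1r expr1n addrC [g s * _ + 1]addrC => ->; rewrite addrC.
apply: (scaling_profile_polynomial psi_smooth Jr (h := h) (G := G)) => //.
- by move=> s /co; exact: h0.
- exact: differentiable_on_derivable hd Jr.
- by move=> t; have [] := Gd t.
- by move=> z; exact: m0.
- by move=> z; exact: zz0.
- move=> z s Js; have [cx x0 rx] := xP s Js; have [y0 uy zy _] := yP z.
  have := E _ (z *: delta_mx 0 ord0 + delta_mx 0 (lift ord0 i2)) cx x0 y0.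
  by rewrite F_psi // rx uy zy !mul1r.
Qed.
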